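(* Let $(r,\Lambda,A)$ be an admissible triple with $\Lambda\neq\{1\}$. Let $G$ be a subgroup of $\mathrm{V}(r,\mathbb R^*_+,\mathbb R)$ such that $$G\cap \mathrm{F}(r,\mathbb R^*_+,\mathbb R)=\mathrm{F}(r,\Lambda,A).$$ Then the group $G$ (in the pure group signature) interprets the Arithmetic $(\mathbb N,+,\times)$ with parameters.
   Context: An admissible triple $(r,\Lambda,A)$ consists of a real $r>0$, a subgroup $\Lambda$ of the multiplicative group $\mathbb R^*_+$ of positive reals, and an additive subgroup $A\subseteq\mathbb R$ with $r\in A$ and $\lambda A\subseteq A$ for all $\lambda\in\Lambda$. Maps act on the right: $(\alpha)x$, and $(\alpha)(xy)=((\alpha)x)y$. $\mathrm{V}(r,\Lambda,A)$ is the group of all bijections $x\colon[0,r)\to[0,r)$ that are piecewise affine with finitely many cuts and singular points (breakpoints), right-continuous at every point, whose affine pieces all have slopes in $\Lambda$, and such that all cut and singular points and their images lie in $A$. $\mathrm{F}(r,\Lambda,A)$ is the subgroup of elements of $\mathrm{V}(r,\Lambda,A)$ continuous for the usual topology of $[0,r)$; $\mathrm{T}(r,\Lambda,A)$ is the subgroup of elements continuous for the circle topology on $[0,r)$ (identifying $[0,r)$ with $[0,r]/\{0,r\}$). An interpretation of a structure $M$ in a structure $N$ with parameters is a pair $(n,f)$ with $n\in\mathbb N$ and $f$ a surjection from a subset of $N^n$ onto $M$ such that for every set $X$ definable in $M$ without parameters (in any $M^k$), the preimage of $X$ under the induced map on $k$-tuples is first-order definable in $N$ using parameters from $N$; it is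 an interpretation without parameters if these preimages are definable without parameters. *)

(* Defs.v *)
From Stdlib Require Import Reals List Arith ClassicalEpsilon.
Import ListNotations.
Open Scope R_scope.

Definition admissible (r : R) (Lam A : R -> Prop) : Prop :=
  0 < r /\
  (forall l, Lam l -> 0 < l) /\ Lam 1 /\
  (forall l m, Lam l -> Lam m -> Lam (l * m)) /\
  (forall l, Lam l -> Lam (/ l)) /\
  A 0 /\ (forall a b, A a -> A b -> A (a + b)) /\ (forall a, A a -> A (- a)) /\
  A r /\ (forall l a, Lam l -> A a -> A (l * a)).

Definition posR : R -> Prop := fun x => 0 < x.
Definition allR : R -> Prop := fun _ => True.

(** * Elements of V(r,Lam,A).
    A bijection of [0,r) is represented by a function R -> R which is the
    identity outside [0,r) (this gives a unique representative). *)
Definition Vel (r : R) (Lam A : R -> Prop) (f : R -> R) : Prop :=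
  (forall t, (t < 0 \/ r <= t) -> f t = t) /\
  (forall t, 0 <= t < r -> 0 <= f t < r) /\
  (forall s t, 0 <= s < r -> 0 <= t < r -> f s = f t -> s = t) /\
  (forall u, 0 <= u < r -> exists t, 0 <= t < r /\ f t = u) /\
  (* finitely many cut/singular points 0 = c_0 < c_1 < ... < c_m = r, all in A,
     with images in A, and f affine with slope in Lam on each [c_i, c_{i+1})
     (hence right-continuous everywhere) *)
  exists c : list R,
    (2 <= length c)%nat /\
    nth 0 c 0 = 0 /\ nth (length c - 1) c 0 = r /\
    (forall i, (S i < length c)%nat ->
       nth i c 0 < nth (S i) c 0 /\ A (nth i c 0) /\ A (f (nth i c 0)) /\
       exists lam b, Lam lam /\
         forall t, nth i c 0 <= t < nth (S i) c 0 -> f t = lam * t + b).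

Definition cont_on_interval (r : R) (f : R -> R) : Prop :=
  forall t, 0 <= t < r -> forall eps, 0 < eps -> exists delta, 0 < delta /\
    forall s, 0 <= s < r -> Rabs (s - t) < delta -> Rabs (f s - f t) < eps.

Definition Fel (r : R) (Lam A : R -> Prop) (f : R -> R) : Prop :=
  Vel r Lam A f /\ cont_on_interval r f.

(** Group operations. Maps act on the right: (t)(xy) = ((t)x)y. *)
Definition idf : R -> R := fun t => t.
Definition gmul (x y : R -> R) : R -> R := fun t => y (x t).
Definition finv (x : R -> R) : R -> R :=
  fun t => epsilon (inhabits 0) (fun s => x s = t).

Definition subgroupV (r : R) (G : (R -> R) -> Prop) : Prop :=
  (forall f, G f -> Vel r posR allR f) /\ G idf /\
  (forall f g, G f -> G g -> G (gmul f g)) /\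
  (forall f, G f -> G (finv f)).

Inductive gterm : Type :=
| GVar : nat -> gterm
| GOne : gterm
| GMul : gterm -> gterm -> gterm
| GInv : gterm -> gterm.

Inductive gform : Type :=
| GEq : gterm -> gterm -> gform
| GNot : gform -> gform
| GAnd : gform -> gform -> gform
| GEx : nat -> gform -> gform.

Definition upd {X : Type} (env : nat -> X) (v : nat) (a : X) : nat -> X :=
  fun w => if Nat.eqb w v then a else env w.

Fixpoint geval (env : nat -> (R -> R)) (t : gterm) : R -> R :=
  match t with
  | GVar v => env v
  | GOne => idf
  | GMul a b => gmul (geval env a) (geval env b)
  | GInv a => finv (geval env a)
  end.

Fixpoint gsat (G : (R -> R) -> Prop) (env : nat -> (R -> R)) (phi : gform) : Prop :=
  match phi with
  | GEq a b => geval env a = geval env b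
  | GNot p => ~ gsat G env p
  | GAnd p q => gsat G env p /\ gsat G env q
  | GEx v p => exists g, G g /\ gsat G (upd env v g) p
  end.

Inductive aterm : Type :=
| AVar : nat -> aterm
| APlus : aterm -> aterm -> aterm
| ATimes : aterm -> aterm -> aterm.

Inductive aform : Type :=
| AEq : aterm -> aterm -> aform
| ANot : aform -> aform
| AAnd : aform -> aform -> aform
| AEx : nat -> aform -> aform.

Fixpoint aeval (env : nat -> nat) (t : aterm) : nat :=
  match t with
  | AVar v => env v
  | APlus a b => (aeval env a + aeval env b)%nat
  | ATimes a b => (aeval env a * aeval env b)%nat
  end.

Fixpoint asat (env : nat -> nat) (phi : aform) : Prop :=
  match phi with
  | AEq a b => aeval env a = aeval env b
  | ANot p => ~ asat env p
  | AAnd p q => asat env p /\ asat env q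
  | AEx v p => exists m : nat, asat (upd env v m) p
  end.

Definition arith_definable (k : nat) (X : list nat -> Prop) : Prop :=
  exists chi : aform, forall env : nat -> nat,
    X (map env (seq 0 k)) <-> asat env chi.

(** Environment for a k-tuple of n-tuples of group elements: variable
    i*n+j (j<n, i<k) is the j-th coordinate of the i-th tuple; variables
    >= n*k take the parameter values rho. *)
Definition tuple_env (n : nat) (tss : list (list (R -> R))) (rho : nat -> (R -> R))
  : nat -> (R -> R) :=
  fun v => if Nat.ltb v (n * length tss) then nth (v mod n) (nth (v / n) tss []) idf
           else rho v.

Definition interprets_arith_with_params (G : (R -> R) -> Prop) : Prop :=
  exists (n : nat) (D : list (R -> R) -> Prop) (f : list (R -> R) -> nat),
    (forall ts, D ts -> length ts = n /\ Forall G ts) /\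
    (forall m : nat, exists ts, D ts /\ f ts = m) /\
    (forall (k : nat) (X : list nat -> Prop), arith_definable k X ->
       exists (psi : gform) (rho : nat -> (R -> R)),
         (forall v, G (rho v)) /\
         forall tss : list (list (R -> R)),
           length tss = k ->
           Forall (fun ts => length ts = n /\ Forall G ts) tss ->
           ((Forall D tss /\ X (map f tss)) <-> gsat G (tuple_env n tss rho) psi)).

(* Main.v *)
Require Import Defs.
From Stdlib Require Import Reals List Lra Lia ZArith Classical ClassicalEpsilon FunctionalExtensionality.
Import ListNotations.
Open Scope R_scope.

(** The number [n] is represented by the [n]-th power of a bump function [shift]
    moving every point of (0,r).  A permutation commuting with a bump function
    agrees on its support with one of its powers, because the product of the
    jumps of the slope along an orbit is invariant under the centralizer, and the
    bumps are chosen so that the orbits through their breakpoints can be told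
    apart by this product.  This needs only piecewise affinity, not continuity, so
    the centralizer of [shift] in G is the cyclic group generated by [shift].  If
    [gen] is a bump supported on a fundamental domain of [shift], then [gen] and
    [shift] generate a wreath product of two infinite cyclic groups, whose base
    group is definable as the common centralizer of the conjugates of [gen] under
    powers of [shift].  The base group is the module of integral Laurent
    polynomials, where [l = m n] is expressed by divisibility of [X^l - 1] by
    [X^m - 1] with a quotient whose value at 1 is [n].  Nonnegative powers of
    [shift] are those conjugating [gen] to an element commuting with a bump
    [low_bump] supported below [gen]. *)

(** * Permutations of the line and their integer powers *)

Definition bij (f : R -> R) : Prop :=
  (forall s t, f s = f t -> s = t) /\ (forall u, exists t, f t = u).

Lemma finvr f t : bij f -> f (finv f t) = t.
Proof.
  intros [_ Hs]. unfold finv.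
  exact (epsilon_spec (inhabits 0) (fun s => f s = t) (Hs t)).
Qed.

Lemma finvl f t : bij f -> finv f (f t) = t.
Proof. intros Hf. apply (proj1 Hf). now apply finvr. Qed.

Lemma finv_unique f g : bij f -> (forall t, f (g t) = t) -> finv f = g.
Proof.
  intros Hf H. extensionality t. apply (proj1 Hf). now rewrite finvr, H.
Qed.

Definition zpow (f : R -> R) (z : Z) : R -> R :=
  if (0 <=? z)%Z then Nat.iter (Z.to_nat z) f else Nat.iter (Z.to_nat (- z)) (finv f).

Lemma zpow_0 f t : zpow f 0 t = t.
Proof. reflexivity. Qed.

Lemma zpow_1 f t : zpow f 1 t = f t.
Proof. reflexivity. Qed.

Lemma zpow_succ f z t : bij f -> zpow f (Z.succ z) t = f (zpow f z t).
Proof.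
  intros Hf. unfold zpow.
  destruct (Z.leb_spec 0 z), (Z.leb_spec 0 (Z.succ z)); try lia.
  - rewrite Z2Nat.inj_succ by lia. reflexivity.
  - replace z with (-1)%Z by lia. simpl. now rewrite finvr.
  - replace (Z.to_nat (- z)) with (S (Z.to_nat (- Z.succ z))) by lia.
    simpl. now rewrite finvr.
Qed.

Lemma zpow_pred f z t : bij f -> zpow f (Z.pred z) t = finv f (zpow f z t).
Proof.
  intros Hf. rewrite <- (Z.succ_pred z) at 2. rewrite zpow_succ by easy. now rewrite finvl.
Qed.

Lemma zpow_add f z w t : bij f -> zpow f (z + w) t = zpow f z (zpow f w t).
Proof.
  intros Hf. revert t. induction z using Z.peano_ind; intros t.
  - reflexivity.
  - rewrite Z.add_succ_l, !zpow_succ by easy. now rewrite IHz.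
  - rewrite Z.add_pred_l, !zpow_pred by easy. now rewrite IHz.
Qed.

Lemma zpow_opp_r f z t : bij f -> zpow f z (zpow f (- z) t) = t.
Proof. intros. rewrite <- zpow_add by easy. now rewrite Z.add_opp_diag_r. Qed.

Lemma zpow_opp_l f z t : bij f -> zpow f (- z) (zpow f z t) = t.
Proof. intros. rewrite <- zpow_add by easy. now rewrite Z.add_opp_diag_l. Qed.

Lemma bij_zpow f z : bij f -> bij (zpow f z).
Proof.
  intros Hf. split.
  - intros s t H. rewrite <- (zpow_opp_l f z s Hf), <- (zpow_opp_l f z t Hf). now rewrite H.
  - intros u. exists (zpow f (- z) u). now apply zpow_opp_r.
Qed.

Lemma finv_zpow f z : bij f -> finv (zpow f z) = zpow f (- z).
Proof.
  intros Hf. apply finv_unique; [now apply bij_zpow|]. intros t. now apply zpow_opp_r.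
Qed.

(** * Commuting permutations and monotone maps *)

Definition comm (f g : R -> R) : Prop := forall t, f (g t) = g (f t).

Lemma comm_sym f g : comm f g -> comm g f.
Proof. intros H t. symmetry. apply H. Qed.

Lemma comm_gmul f g h : comm f h -> comm g h -> comm (gmul f g) h.
Proof. intros H1 H2 t. unfold gmul. now rewrite H1, H2. Qed.

Lemma comm_finv f g : bij f -> comm f g -> comm (finv f) g.
Proof.
  intros Hf H t. apply (proj1 Hf). now rewrite H, !finvr.
Qed.

Lemma comm_zpow f g z : bij f -> comm f g -> comm (zpow f z) g.
Proof.
  intros Hf H t. revert t. induction z using Z.peano_ind; intros t.
  - reflexivity.
  - rewrite !zpow_succ by easy. now rewrite IHz, H.
  - rewrite !zpow_pred by easy. now rewrite IHz, (comm_finv f g).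
Qed.

(** A permutation maps the set of points it moves onto itself. Hence if one map moves [t], the other
    fixes both [t] and its image. *)
Lemma comm_disjoint f g : bij f -> bij g -> (forall t, f t = t \/ g t = t) -> comm f g.
Proof.
  intros Hf Hg H t.
  destruct (H t) as [Hx|Hx].
  - destruct (H (g t)) as [Hy|Hy]; [congruence|].
    apply (proj1 Hg) in Hy. congruence.
  - destruct (H (f t)) as [Hy|Hy]; [|congruence].
    apply (proj1 Hf) in Hy. congruence.
Qed.

Lemma zpow_invariant f (P : R -> Prop) z t :
  bij f -> (forall t, P (f t) <-> P t) -> (P (zpow f z t) <-> P t).
Proof.
  intros Hf H. induction z using Z.peano_ind.
  - reflexivity.
  - rewrite zpow_succ by easy. now rewrite H.
  - rewrite zpow_pred by easy. rewrite <- H. now rewrite finvr.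
Qed.

Definition strictly_increasing (f : R -> R) : Prop := forall s t, s < t -> f s < f t.

Lemma increasing_iff f s t : strictly_increasing f -> (f s < f t <-> s < t).
Proof.
  intros H. split; [|apply H]. intros Hst.
  destruct (Rtotal_order s t) as [|[->|Hts]]; [easy|lra|].
  apply H in Hts. lra.
Qed.

Lemma increasing_le_iff f s t : strictly_increasing f -> (f s <= f t <-> s <= t).
Proof.
  intros H. split; intros Hst; apply Rnot_lt_le; intros Hts.
  - apply H in Hts. lra.
  - apply increasing_iff in Hts; [lra|easy].
Qed.

Lemma increasing_zpow f z : bij f -> strictly_increasing f -> strictly_increasing (zpow f z).
Proof.
  intros Hf Hi. induction z using Z.peano_ind; intros s t Hst.
  - exact Hst.
  - rewrite !zpow_succ by easy. now apply Hi, IHz.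
  - rewrite !zpow_pred by easy. apply (increasing_iff f); [easy|]. rewrite !finvr by easy.
    now apply IHz.
Qed.

(** * Local slopes of piecewise affine maps *)

Definition right_affine (f : R -> R) (x : R) : Prop :=
  exists s e, 0 < s /\ 0 < e /\ forall t, x <= t < x + e -> f t = f x + s * (t - x).

(** The affine formula has a free constant [b] because a right-continuous map may jump at [x], so
    its left limit need not be [f x]. *)
Definition left_affine (f : R -> R) (x : R) : Prop :=
  exists s b e, 0 < s /\ 0 < e /\ forall t, x - e <= t < x -> f t = s * t + b.

(** [q] is the quotient of the right slope by the left slope at [x]. Both formulas start from [f x],
    so continuity at [x] is included. *)
Definition slope_ratio (f : R -> R) (x q : R) : Prop :=
  exists s e, 0 < s /\ 0 < e /\
    (forall t, x - e < t <= x -> f t = f x + s * (t - x)) /\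
    (forall t, x <= t < x + e -> f t = f x + q * s * (t - x)).

Lemma scaled_close k d e t : 0 < k -> Rabs t < d -> d <= e / k -> Rabs (k * t) < e.
Proof.
  intros Hk Ht Hd. rewrite Rabs_mult, (Rabs_pos_eq k) by lra.
  assert (k * Rabs t < k * (e / k)) by (apply Rmult_lt_compat_l; lra).
  replace (k * (e / k)) with e in H by (field; lra). easy.
Qed.

(** This is the chain rule for the two one-sided slopes: [f] is increasing near [x], so it respects
    the sides, and the quotients multiply. *)
Lemma slope_ratio_comp f g x q q' :
  0 < q -> slope_ratio f x q -> slope_ratio g (f x) q' -> slope_ratio (fun t => g (f t)) x (q * q').
Proof.
  intros Hq (s & e & Hs & He & Hl & Hr) (s' & e' & Hs' & He' & Hl' & Hr').
  assert (Hqs : 0 < q * s) by nra.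
  (* Points on the left are stretched by [s] and points on the right by [q * s]. Dividing [e'] by
     both factors keeps the images where [g] is known. *)
  exists (s' * s), (Rmin e (Rmin (e' / s) (e' / (q * s)))).
  split; [nra|]. split.
  { repeat apply Rmin_glb_lt; try easy; apply Rdiv_lt_0_compat; lra. }
  assert (M1 := Rmin_l e (Rmin (e' / s) (e' / (q * s)))).
  assert (M2 := Rmin_r e (Rmin (e' / s) (e' / (q * s)))).
  assert (M3 := Rmin_l (e' / s) (e' / (q * s))).
  assert (M4 := Rmin_r (e' / s) (e' / (q * s))).
  set (d := Rmin e (Rmin (e' / s) (e' / (q * s)))) in *.
  split; intros t Ht.
  - assert (B : Rabs (s * (t - x)) < e').
    { apply (scaled_close s d); [easy| |lra]. apply Rabs_def1; lra. }
    apply Rabs_def2 in B.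
    assert (0 <= s * (x - t)) by (apply Rmult_le_pos; lra).
    rewrite (Hl t) by lra. rewrite Hl' by lra. ring.
  - assert (B : Rabs (q * s * (t - x)) < e').
    { apply (scaled_close (q * s) d); [easy| |lra]. apply Rabs_def1; lra. }
    apply Rabs_def2 in B.
    assert (0 <= q * s * (t - x)) by (apply Rmult_le_pos; lra).
    rewrite (Hr t) by lra. rewrite Hr' by lra. ring.
Qed.

Lemma slope_ratio_unique f x q q' : slope_ratio f x q -> slope_ratio f x q' -> q = q'.
Proof.
  intros (s & e & Hs & He & Hl & Hr) (s' & e' & Hs' & He' & Hl' & Hr').
  assert (M1 := Rmin_l e e'). assert (M2 := Rmin_r e e').
  assert (M3 : 0 < Rmin e e') by now apply Rmin_glb_lt.
  set (d := Rmin e e' / 2).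
  assert (Hd : 0 < d < Rmin e e') by (unfold d; lra).
  assert (s = s').
  { specialize (Hl (x - d)). specialize (Hl' (x - d)).
    apply (Rmult_eq_reg_r d); [|lra].
    assert (f (x - d) = f x - s * d) by (rewrite Hl by lra; ring).
    assert (f (x - d) = f x - s' * d) by (rewrite Hl' by lra; ring). lra. }
  subst s'. apply (Rmult_eq_reg_r s); [|lra]. apply (Rmult_eq_reg_r d); [|lra].
  assert (f (x + d) = f x + q * s * d) by (rewrite Hr by lra; ring).
  assert (f (x + d) = f x + q' * s * d) by (rewrite Hr' by lra; ring). lra.
Qed.

Lemma slope_ratio_affine f x u v s b :
  0 < s -> u < x < v -> (forall t, u < t < v -> f t = s * t + b) -> slope_ratio f x 1.
Proof.
  intros Hs Hx H. exists s, (Rmin (x - u) (v - x)).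
  assert (M1 := Rmin_l (x - u) (v - x)). assert (M2 := Rmin_r (x - u) (v - x)).
  split; [easy|]. split; [apply Rmin_glb_lt; lra|].
  split; intros t Ht; rewrite (H t), (H x) by lra; ring.
Qed.

Lemma slope_ratio_piecewise f x u v s s' b b' :
  0 < s -> u < x < v -> (forall t, u < t <= x -> f t = s * t + b) ->
  (forall t, x <= t < v -> f t = s' * t + b') -> slope_ratio f x (s' / s).
Proof.
  intros Hs Hx H H'. exists s, (Rmin (x - u) (v - x)).
  assert (M1 := Rmin_l (x - u) (v - x)). assert (M2 := Rmin_r (x - u) (v - x)).
  split; [easy|]. split; [apply Rmin_glb_lt; lra|].
  split; intros t Ht.
  - rewrite (H t), (H x) by lra. ring.
  - rewrite (H' t), (H' x) by lra. field. lra.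
Qed.

(** * One-sided affinity of the elements of V *)

Section PiecewiseAffine.

Variables (r : R) (Lam A : R -> Prop) (f : R -> R).
Hypothesis LamPos : forall l, Lam l -> 0 < l.
Hypothesis Vf : Vel r Lam A f.

Lemma Vel_bij : bij f.
Proof.
  destruct Vf as (Hout & Hin & Hinj & Hsur & _).
  assert (D : forall t, (t < 0 \/ r <= t) \/ 0 <= t < r) by (intro; lra).
  split.
  - intros s t H.
    destruct (D s) as [Hs|Hs], (D t) as [Ht|Ht].
    + now rewrite !Hout in H.
    + rewrite (Hout s) in H by easy. specialize (Hin t Ht). lra.
    + rewrite (Hout t) in H by easy. specialize (Hin s Hs). lra.
    + now apply Hinj.
  - intros u. destruct (D u) as [Hu|Hu].
    + exists u. now apply Hout.
    + destruct (Hsur u Hu) as (t & _ & Ht). now exists t.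
Qed.

(** At a cut, the piece starting at [x] and the piece ending there differ, so they are produced
    separately. The second also exists at [x = r]. *)
Lemma Vel_pieces x : 0 <= x <= r ->
  (x < r -> exists u v l b, u <= x < v /\ 0 < l /\ forall t, u <= t < v -> f t = l * t + b) /\
  (0 < x -> exists u v l b, u < x <= v /\ 0 < l /\ forall t, u <= t < v -> f t = l * t + b).
Proof.
  intros Hx. destruct Vf as (_ & _ & _ & _ & c & Hlen & H0 & Hr & Hc).
  (* Induction on the index of a cut bounding [x] from above: either an earlier cut bounds it
     already, or the last piece is the one sought. *)
  assert (E : forall n, (n < length c)%nat ->
    (x < nth n c 0 -> exists i, (S i < length c)%nat /\ nth i c 0 <= x < nth (S i) c 0) /\
    (0 < x -> x <= nth n c 0 -> exists i, (S i < length c)%nat /\ nth i c 0 < x <= nth (S i) c 0)).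
  { induction n as [|n IH]; intros Hn.
    - rewrite H0. split; lra.
    - specialize (IH ltac:(lia)). split.
      + intros H. destruct (Rlt_le_dec x (nth n c 0)) as [L|L]; [now apply IH|].
        exists n. split; [easy|lra].
      + intros Hp H. destruct (Rle_lt_dec x (nth n c 0)) as [L|L]; [now apply IH|].
        exists n. split; [easy|lra]. }
  destruct (E (length c - 1)%nat ltac:(lia)) as [E1 E2]. rewrite Hr in E1, E2.
  split; intros H; [destruct (E1 H) as (i & Hi & Hix) | destruct (E2 H ltac:(lra)) as (i & Hi & Hix)];
    destruct (Hc i Hi) as (_ & _ & _ & l & b & Hl & Hf);
    exists (nth i c 0), (nth (S i) c 0), l, b; auto.
Qed.

Lemma Vel_right_affine x : 0 <= x < r -> right_affine f x.
Proof.
  intros Hx. destruct (Vel_pieces x) as [H _]; [lra|].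
  destruct H as (u & v & l & b & Hu & Hl & H); [lra|].
  exists l, (v - x). split; [easy|]. split; [lra|].
  intros t Ht. rewrite (H t), (H x) by lra. ring.
Qed.

Lemma Vel_left_affine x : 0 < x <= r -> left_affine f x.
Proof.
  intros Hx. destruct (Vel_pieces x) as [_ H]; [lra|].
  destruct H as (u & v & l & b & Hu & Hl & H); [lra|].
  exists l, b, (x - u). split; [easy|]. split; [lra|].
  intros t Ht. apply H. lra.
Qed.

End PiecewiseAffine.

(** * Bump functions *)

(** On [p,q] the bump is the concave map with slopes [/k], [1], [k^2] and
    breakpoints [brk1], [brk2], which lie in [A] as soon as [p], [q] do.  The
    slope ratios [k] and [k^2] at the breakpoints have exponents of different
    parity. *)
Definition bump (k p q t : R) : R :=
  Rmax t (Rmin (p + (t - p) / k) (Rmin (t + (q - p) * (k - k ^ 3)) (q - k ^ 2 * (q - t)))).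

Definition brk1 (k p q : R) : R := p + (q - p) * (k ^ 2 + k ^ 3).
Definition brk2 (k p q : R) : R := q - (q - p) * k.

(** Bounds on difference quotients survive minima and maxima, so a bump inherits them from its
    affine constituents without a case distinction. The lower bound gives monotonicity, the upper
    one continuity. *)
Definition slope_between (m M : R) (f : R -> R) : Prop :=
  forall s t, s <= t -> m * (t - s) <= f t - f s <= M * (t - s).

Lemma slope_between_min m M f g :
  slope_between m M f -> slope_between m M g -> slope_between m M (fun t => Rmin (f t) (g t)).
Proof.
  intros Hf Hg s t Hst. specialize (Hf s t Hst). specialize (Hg s t Hst).
  unfold Rmin. destruct (Rle_dec (f s) (g s)), (Rle_dec (f t) (g t)); lra.
Qed.

Lemma slope_between_max m M f g :
  slope_between m M f -> slope_between m M g -> slope_between m M (fun t => Rmax (f t) (g t)).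
Proof.
  intros Hf Hg s t Hst. specialize (Hf s t Hst). specialize (Hg s t Hst).
  unfold Rmax. destruct (Rle_dec (f s) (g s)), (Rle_dec (f t) (g t)); lra.
Qed.

Lemma slope_between_affine m M s b : m <= s <= M -> slope_between m M (fun t => s * t + b).
Proof.
  intros H u v Huv.
  assert (0 <= (s - m) * (v - u)) by (apply Rmult_le_pos; lra).
  assert (0 <= (M - s) * (v - u)) by (apply Rmult_le_pos; lra). lra.
Qed.

Section Bump.

Variables k p q : R.
Hypothesis Hk : 0 < k <= 1 / 4.
Hypothesis Hpq : p < q.

Notation beta := (bump k p q).
Notation x1 := (brk1 k p q).
Notation x2 := (brk2 k p q).

Lemma inv_k_ge : 4 <= / k.
Proof.
  apply (Rmult_le_reg_r k); [lra|]. rewrite Rinv_l by lra. lra.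
Qed.

Lemma k2_bound : 0 < k ^ 2 <= 1 / 16.
Proof. split; nra. Qed.

Lemma k3_bound : 0 < k ^ 3 <= 1 / 64.
Proof. pose proof k2_bound. replace (k ^ 3) with (k * k ^ 2) by ring. split; nra. Qed.

Lemma brk_order : p < x1 < x2 /\ x2 < q.
Proof.
  pose proof k2_bound. pose proof k3_bound.
  unfold brk1, brk2. split; [split|]; nra.
Qed.

Lemma bump_left t : t <= p -> beta t = t.
Proof.
  intros H. pose proof inv_k_ge. unfold bump. apply Rmax_left.
  eapply Rle_trans; [apply Rmin_l|]. unfold Rdiv. nra.
Qed.

Lemma bump_right t : q <= t -> beta t = t.
Proof.
  intros H. pose proof k2_bound. unfold bump. apply Rmax_left.
  eapply Rle_trans; [apply Rmin_r|]. eapply Rle_trans; [apply Rmin_r|]. nra.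
Qed.

(** The line of the middle piece meets the two outer lines at [x1] and [x2], and the outer lines
    meet the diagonal at [p] and [q]. The signs of these factored differences decide every minimum
    and maximum in [bump]. *)
Let d12 t : p + (t - p) / k - (t + (q - p) * (k - k ^ 3)) = (/ k - 1) * (t - x1).
Proof. unfold brk1. field. lra. Qed.

Let d32 t : q - k ^ 2 * (q - t) - (t + (q - p) * (k - k ^ 3)) = (1 - k ^ 2) * (x2 - t).
Proof. unfold brk2. ring. Qed.

Let d1 t : p + (t - p) / k - t = (/ k - 1) * (t - p).
Proof. field. lra. Qed.

Let d3 t : q - k ^ 2 * (q - t) - t = (1 - k ^ 2) * (q - t).
Proof. ring. Qed.

Let d2 : 0 < (q - p) * (k - k ^ 3).
Proof. pose proof k2_bound. apply Rmult_lt_0_compat; [lra|]. nra. Qed.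

Let nonneg a x : 0 < a -> 0 <= x -> 0 <= a * x.
Proof. intros; apply Rmult_le_pos; lra. Qed.

Lemma bump_piece1 t : p <= t <= x1 -> beta t = p + (t - p) / k.
Proof.
  intros H. pose proof inv_k_ge. pose proof k2_bound. pose proof brk_order.
  specialize (d12 t). specialize (d32 t). specialize (d1 t). specialize (d3 t).
  pose proof (nonneg (/ k - 1) (x1 - t) ltac:(lra) ltac:(lra)).
  pose proof (nonneg (/ k - 1) (t - p) ltac:(lra) ltac:(lra)).
  pose proof (nonneg (1 - k ^ 2) (x2 - t) ltac:(lra) ltac:(lra)).
  unfold bump. set (u := p + (t - p) / k) in *.
  unfold Rmax, Rmin. repeat destruct Rle_dec; lra.
Qed.

Lemma bump_piece2 t : x1 <= t <= x2 -> beta t = t + (q - p) * (k - k ^ 3).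
Proof.
  intros H. pose proof inv_k_ge. pose proof k2_bound. pose proof brk_order.
  specialize (d12 t). specialize (d32 t).
  pose proof (nonneg (/ k - 1) (t - x1) ltac:(lra) ltac:(lra)).
  pose proof (nonneg (1 - k ^ 2) (x2 - t) ltac:(lra) ltac:(lra)).
  unfold bump. set (u := p + (t - p) / k) in *.
  unfold Rmax, Rmin. repeat destruct Rle_dec; lra.
Qed.

Lemma bump_piece3 t : x2 <= t <= q -> beta t = q - k ^ 2 * (q - t).
Proof.
  intros H. pose proof inv_k_ge. pose proof k2_bound. pose proof brk_order.
  specialize (d12 t). specialize (d32 t). specialize (d3 t).
  pose proof (nonneg (/ k - 1) (t - x1) ltac:(lra) ltac:(lra)).
  pose proof (nonneg (1 - k ^ 2) (t - x2) ltac:(lra) ltac:(lra)).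
  pose proof (nonneg (1 - k ^ 2) (q - t) ltac:(lra) ltac:(lra)).
  unfold bump. set (u := p + (t - p) / k) in *.
  unfold Rmax, Rmin. repeat destruct Rle_dec; lra.
Qed.

Lemma bump_slope : slope_between (k ^ 2) (/ k) beta.
Proof.
  pose proof inv_k_ge. pose proof k2_bound.
  assert (E : forall s b f, (forall t, f t = s * t + b) -> k ^ 2 <= s <= / k ->
    slope_between (k ^ 2) (/ k) f).
  { intros s b f Hf Hs. replace f with (fun t => s * t + b).
    - now apply slope_between_affine.
    - extensionality t. now rewrite Hf. }
  unfold bump. apply slope_between_max; [|apply slope_between_min; [|apply slope_between_min]].
  - apply (E 1 0); [intros; ring|lra].
  - apply (E (/ k) (p - p / k)); [intros; field; lra|lra].
  - apply (E 1 ((q - p) * (k - k ^ 3))); [intros; ring|lra].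
  - apply (E (k ^ 2) (q - k ^ 2 * q)); [intros; ring|lra].
Qed.

Lemma bump_increasing : strictly_increasing beta.
Proof.
  intros s t H. destruct (bump_slope s t) as [L _]; [lra|].
  pose proof k2_bound. assert (0 < k ^ 2 * (t - s)) by (apply Rmult_lt_0_compat; lra). lra.
Qed.

Lemma bump_bij : bij beta.
Proof.
  split.
  - intros s t H. destruct (Rtotal_order s t) as [L|[L|L]]; [|easy|];
      apply bump_increasing in L; lra.
  - pose proof brk_order. pose proof k2_bound. pose proof inv_k_ge.
    (* Neighbouring pieces agree at the breakpoints, so their images cover [[p,q]] and each [u] is
       reached by inverting a single affine map. *)
    assert (E1 : p + (x1 - p) / k = x1 + (q - p) * (k - k ^ 3)) by (unfold brk1; field; lra).
    assert (E2 : x2 + (q - p) * (k - k ^ 3) = q - k ^ 2 * (q - x2)) by (unfold brk2; ring).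
    intros u.
    destruct (Rle_lt_dec u p); [exists u; now apply bump_left|].
    destruct (Rle_lt_dec q u); [exists u; now apply bump_right|].
    destruct (Rle_lt_dec u (p + (x1 - p) / k)) as [L|L].
    { exists (p + k * (u - p)). rewrite bump_piece1; [field; lra|]. split; [nra|].
      assert (k * (u - p) <= k * ((x1 - p) / k)) by (apply Rmult_le_compat_l; lra).
      replace (k * ((x1 - p) / k)) with (x1 - p) in * by (field; lra). lra. }
    destruct (Rle_lt_dec u (x2 + (q - p) * (k - k ^ 3))) as [L'|L'].
    { exists (u - (q - p) * (k - k ^ 3)). rewrite bump_piece2; lra. }
    exists (q - (q - u) / k ^ 2). rewrite bump_piece3; [field; lra|].
    assert (0 < / k ^ 2) by (apply Rinv_0_lt_compat; lra).
    split; [|unfold Rdiv; nra].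
    assert ((q - u) / k ^ 2 <= (k ^ 2 * (q - x2)) / k ^ 2).
    { unfold Rdiv. apply Rmult_le_compat_r; lra. }
    replace ((k ^ 2 * (q - x2)) / k ^ 2) with (q - x2) in * by (field; lra). lra.
Qed.

(** * Orbits of a bump function *)

Lemma bump_interval t : p < beta t < q <-> p < t < q.
Proof.
  rewrite <- (increasing_iff beta p t bump_increasing), <- (increasing_iff beta t q bump_increasing).
  now rewrite (bump_left p), (bump_right q) by lra.
Qed.

Lemma zpow_bump_interval z t : p < zpow beta z t < q <-> p < t < q.
Proof.
  apply (zpow_invariant beta (fun t => p < t < q)); [apply bump_bij | apply bump_interval].
Qed.

Lemma zpow_bump_outside z t : ~ p < t < q -> zpow beta z t = t.
Proof.
  intros Ht.
  assert (E : beta t = t).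
  { destruct (Rle_lt_dec t p); [now apply bump_left|].
    destruct (Rle_lt_dec q t); [now apply bump_right|]. lra. }
  induction z using Z.peano_ind.
  - reflexivity.
  - rewrite zpow_succ by apply bump_bij. congruence.
  - rewrite zpow_pred by apply bump_bij. rewrite IHz. rewrite <- E at 1.
    apply finvl, bump_bij.
Qed.

(** The displacement is at least the minimum of an increasing affine function, a constant and a
    decreasing one. On [[s,t]] the first is least at [s], the last at [t]. The bound is uniform,
    which makes orbits escape. *)
Lemma bump_displacement s t x : p < s -> t < q -> s <= x <= t ->
  Rmin ((/ k - 1) * (s - p)) (Rmin ((q - p) * (k - k ^ 3)) ((1 - k ^ 2) * (q - t))) <= beta x - x.
Proof.
  intros Hs Ht Hx. pose proof inv_k_ge. pose proof k2_bound.
  assert ((/ k - 1) * (s - p) <= p + (x - p) / k - x).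
  { rewrite d1. apply Rmult_le_compat_l; lra. }
  assert ((1 - k ^ 2) * (q - t) <= q - k ^ 2 * (q - x) - x).
  { rewrite d3. apply Rmult_le_compat_l; lra. }
  unfold bump. eapply Rle_trans; [|apply Rplus_le_compat_r, Rmax_r].
  unfold Rmin. repeat destruct Rle_dec; lra.
Qed.

Lemma bump_moves t : p < t < q -> t < beta t.
Proof.
  intros Ht. pose proof inv_k_ge. pose proof k2_bound.
  pose proof (bump_displacement t t t ltac:(lra) ltac:(lra) ltac:(lra)) as H1.
  assert (0 < Rmin ((/ k - 1) * (t - p)) (Rmin ((q - p) * (k - k ^ 3)) ((1 - k ^ 2) * (q - t)))); [|lra].
  repeat apply Rmin_glb_lt; [nra|apply d2|nra].
Qed.

Lemma bump_ge t : t <= beta t.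
Proof. unfold bump. apply Rmax_l. Qed.

Lemma zpow_bump_lt z w t : p < t < q -> (z < w)%Z -> zpow beta z t < zpow beta w t.
Proof.
  intros Ht Hzw.
  assert (E : forall n, zpow beta z t < zpow beta (z + Z.of_nat (S n)) t).
  { induction n as [|n IH].
    - change (Z.of_nat 1) with 1%Z. rewrite Z.add_1_r, zpow_succ by apply bump_bij.
      now apply bump_moves, zpow_bump_interval.
    - rewrite Nat2Z.inj_succ, Z.add_succ_r, zpow_succ by apply bump_bij.
      pose proof (bump_ge (zpow beta (z + Z.of_nat (S n)) t)). lra. }
  specialize (E (Z.to_nat (w - z - 1))).
  now replace (z + Z.of_nat (S (Z.to_nat (w - z - 1))))%Z with w in E by lia.
Qed.

Lemma zpow_bump_le z w t : p < t < q -> (z <= w)%Z -> zpow beta z t <= zpow beta w t.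
Proof.
  intros Ht Hzw. destruct (Z.eq_dec z w) as [->|]; [lra|].
  left. apply zpow_bump_lt; [easy|lia].
Qed.

Lemma zpow_bump_inj z w t : p < t < q -> zpow beta z t = zpow beta w t -> z = w.
Proof.
  intros Ht H. destruct (Z.lt_trichotomy z w) as [L|[L|L]]; [|easy|];
    apply (zpow_bump_lt _ _ t Ht) in L; lra.
Qed.

(** Until it has passed [t], the orbit of [s] advances by at least a fixed [d > 0] at each step, so
    the Archimedean property applies. *)
Lemma bump_escape s t : p < s < q -> p < t < q ->
  exists N, (0 <= N)%Z /\ forall z, (N <= z)%Z -> t < zpow beta z s.
Proof.
  intros Hs Ht. pose proof inv_k_ge. pose proof k2_bound.
  set (d := Rmin ((/ k - 1) * (s - p)) (Rmin ((q - p) * (k - k ^ 3)) ((1 - k ^ 2) * (q - t)))).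
  assert (Hd : 0 < d) by (repeat apply Rmin_glb_lt; [nra|apply d2|nra]).
  assert (E : forall n, t < zpow beta (Z.of_nat n) s \/
                        s + INR n * d <= zpow beta (Z.of_nat n) s).
  { induction n as [|n IH].
    - right. rewrite zpow_0. simpl. lra.
    - rewrite Nat2Z.inj_succ, zpow_succ, S_INR by apply bump_bij.
      set (y := zpow beta (Z.of_nat n) s) in *.
      destruct (Rlt_le_dec t y) as [L|L].
      + left. pose proof (bump_ge y). lra.
      + right. destruct IH as [|IH]; [lra|].
        assert (0 <= INR n * d) by (apply Rmult_le_pos; [apply pos_INR|lra]).
        pose proof (bump_displacement s t y ltac:(lra) ltac:(lra) ltac:(lra)) as H2.
        fold d in H2. lra. }
  destruct (INR_unbounded ((t - s) / d)) as [n Hn].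
  exists (Z.of_nat n). split; [lia|]. intros z Hz.
  apply Rlt_le_trans with (zpow beta (Z.of_nat n) s); [|now apply zpow_bump_le].
  destruct (E n) as [L|L]; [easy|].
  apply (Rmult_lt_compat_r d) in Hn; [|easy].
  replace ((t - s) / d * d) with (t - s) in Hn by (field; lra). lra.
Qed.

Lemma bump_escape_down s t : p < s < q -> p < t < q ->
  exists N, (0 <= N)%Z /\ forall z, (N <= z)%Z -> zpow beta (- z) t < s.
Proof.
  intros Hs Ht. destruct (bump_escape s t Hs Ht) as (N & HN & H).
  exists N. split; [easy|]. intros z Hz.
  apply (increasing_iff (zpow beta z)).
  - apply increasing_zpow; [apply bump_bij | apply bump_increasing].
  - rewrite zpow_opp_r by apply bump_bij. now apply H.
Qed.

Lemma slope_ratio_bump x : p < x < q ->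
  slope_ratio beta x (if Req_dec_T x x1 then k else if Req_dec_T x x2 then k ^ 2 else 1).
Proof.
  intros Hx. pose proof brk_order. pose proof inv_k_ge. pose proof k2_bound.
  assert (P1 : forall t, p <= t <= x1 -> beta t = / k * t + (p - p / k)).
  { intros. rewrite bump_piece1 by easy. field. lra. }
  assert (P2 : forall t, x1 <= t <= x2 -> beta t = 1 * t + (q - p) * (k - k ^ 3)).
  { intros. rewrite bump_piece2 by easy. ring. }
  assert (P3 : forall t, x2 <= t <= q -> beta t = k ^ 2 * t + (q - k ^ 2 * q)).
  { intros. rewrite bump_piece3 by easy. ring. }
  destruct (Req_dec_T x x1) as [->|N1]; [|destruct (Req_dec_T x x2) as [->|N2]].
  - cut (slope_ratio beta x1 (1 / / k)); [now replace (1 / / k) with k by (field; lra)|].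
    eapply (slope_ratio_piecewise beta x1 p x2); [| |intros; apply P1|intros; apply P2]; lra.
  - cut (slope_ratio beta x2 (k ^ 2 / 1)); [now replace (k ^ 2 / 1) with (k ^ 2) by field|].
    eapply (slope_ratio_piecewise beta x2 x1 q); [| |intros; apply P2|intros; apply P3]; lra.
  - destruct (Rlt_le_dec x x1) as [L|L]; [|destruct (Rlt_le_dec x x2) as [L'|L']].
    + eapply (slope_ratio_affine beta x p x1); [| |intros; apply P1]; lra.
    + eapply (slope_ratio_affine beta x x1 x2); [| |intros; apply P2]; lra.
    + eapply (slope_ratio_affine beta x x2 q); [| |intros; apply P3]; lra.
Qed.

End Bump.

(** * Centralizers of bump functions *)

Lemma bump_Fel r Lam A k p q :
  admissible r Lam A -> Lam k -> 0 < k <= 1 / 4 ->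
  0 <= p < q -> q <= r -> A p -> A q -> Fel r Lam A (bump k p q).
Proof.
  intros (Hr & HLp & HL1 & HLm & HLi & HA0 & HAa & HAo & HAr & HAm) HLk Hk Hpq Hqr Ap Aq.
  assert (Hpq' : p < q) by lra.
  pose proof (brk_order k p q Hk Hpq') as Ho.
  assert (AL : A (q - p)) by (apply HAa; auto).
  assert (AL1 : A (k * (q - p))) by auto.
  assert (AL2 : A (k * (k * (q - p)))) by auto.
  assert (AL3 : A (k * (k * (k * (q - p))))) by auto.
  assert (A1 : A (brk1 k p q)).
  { replace (brk1 k p q) with (p + (k * (k * (q - p)) + k * (k * (k * (q - p)))))
      by (unfold brk1; ring). auto. }
  assert (A2 : A (brk2 k p q)).
  { replace (brk2 k p q) with (q + - (k * (q - p))) by (unfold brk2; ring). auto. }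
  set (beta := bump k p q) in *.
  (* [seg] is the condition that [Vel] imposes on two consecutive cuts. *)
  pose (seg u v := u < v /\ A u /\ A (beta u) /\
    exists lam b, Lam lam /\ forall t, u <= t < v -> beta t = lam * t + b).
  assert (S1 : 0 < p -> seg 0 p).
  { intros H. unfold seg, beta. rewrite bump_left by lra. repeat split; auto.
    exists 1, 0. split; [easy|]. intros t Ht. rewrite bump_left by lra. ring. }
  assert (S2 : seg p (brk1 k p q)).
  { unfold seg, beta. rewrite bump_left by lra. repeat split; auto; [lra|].
    exists (/ k), (p - p / k). split; [auto|].
    intros t Ht. rewrite bump_piece1 by lra. field. lra. }
  assert (S3 : seg (brk1 k p q) (brk2 k p q)).
  { unfold seg, beta. repeat split; auto; [lra| |].
    - rewrite bump_piece1 by lra.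
      replace (p + (brk1 k p q - p) / k) with (p + (k * (q - p) + k * (k * (q - p))))
        by (unfold brk1; field; lra). auto.
    - exists 1, ((q - p) * (k - k ^ 3)). split; [auto|].
      intros t Ht. rewrite bump_piece2 by lra. ring. }
  assert (S4 : seg (brk2 k p q) q).
  { unfold seg, beta. repeat split; auto; [lra| |].
    - rewrite bump_piece3 by lra.
      replace (q - k ^ 2 * (q - brk2 k p q)) with (q + - (k * (k * (k * (q - p)))))
        by (unfold brk2; ring). auto.
    - exists (k * k), (q - k ^ 2 * q). split; [auto|].
      intros t Ht. rewrite bump_piece3 by lra. ring. }
  assert (S5 : q < r -> seg q r).
  { intros H. unfold seg, beta. rewrite bump_right by lra. repeat split; auto.
    exists 1, 0. split; [easy|]. intros t Ht. rewrite bump_right by lra. ring. }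
  assert (Hin : forall t, 0 <= beta t < r <-> 0 <= t < r).
  { intros t.
    rewrite <- (increasing_le_iff beta 0 t), <- (increasing_iff beta t r)
      by (apply bump_increasing; lra).
    unfold beta. now rewrite (bump_left k p q Hk 0), (bump_right k p q Hk r) by lra. }
  split; [split; [|split; [|split; [|split]]]|].
  - intros t Ht. unfold beta.
    destruct Ht; [apply bump_left | apply bump_right]; lra.
  - intros t. apply Hin.
  - intros s t _ _. apply (proj1 (bump_bij k p q Hk Hpq')).
  - intros u Hu. destruct (proj2 (bump_bij k p q Hk Hpq') u) as [t Ht].
    exists t. split; [|easy]. apply Hin. unfold beta. now rewrite Ht.
  (* The cuts must increase strictly, so [0] and [r] are listed separately only if they differ from
     [p] and [q]. *)
  - destruct (Rle_lt_or_eq_dec 0 p) as [P0|P0]; [lra| |];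
      (destruct (Rle_lt_or_eq_dec q r) as [Q0|Q0]; [lra| |]).
    + exists [0; p; brk1 k p q; brk2 k p q; q; r]. split; [simpl; lia|]. split; [easy|]. split; [easy|].
      intros i Hi. destruct i as [|[|[|[|[|i]]]]]; simpl in Hi; try lia; simpl;
        first [now apply S1 | now apply S2 | now apply S3 | now apply S4 | now apply S5].
    + exists [0; p; brk1 k p q; brk2 k p q; q]. split; [simpl; lia|]. split; [easy|]. split; [easy|].
      intros i Hi. destruct i as [|[|[|[|i]]]]; simpl in Hi; try lia; simpl;
        first [now apply S1 | now apply S2 | now apply S3 | now apply S4 | now apply S5].
    + exists [p; brk1 k p q; brk2 k p q; q; r]. split; [simpl; lia|]. split; [easy|]. split; [easy|].
      intros i Hi. destruct i as [|[|[|[|i]]]]; simpl in Hi; try lia; simpl;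
        first [now apply S1 | now apply S2 | now apply S3 | now apply S4 | now apply S5].
    + exists [p; brk1 k p q; brk2 k p q; q]. split; [simpl; lia|]. split; [easy|]. split; [easy|].
      intros i Hi. destruct i as [|[|[|i]]]; simpl in Hi; try lia; simpl;
        first [now apply S1 | now apply S2 | now apply S3 | now apply S4 | now apply S5].
  (* [/ k] is a Lipschitz constant of the bump. *)
  - intros t Ht eps Heps. exists (k * eps). split; [apply Rmult_lt_0_compat; lra|].
    intros s Hs Hst. pose proof (bump_slope k p q Hk) as Hb. fold beta in Hb.
    assert (E : forall u v, u <= v -> v - u < k * eps -> Rabs (beta v - beta u) < eps).
    { intros u v Huv Hd. destruct (Hb u v Huv) as [L U].
      assert (0 <= k ^ 2 * (v - u)) by (apply Rmult_le_pos; [pose proof (k2_bound k Hk)|]; lra).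
      assert (/ k * (v - u) < eps).
      { apply (Rmult_lt_reg_l k); [lra|]. rewrite <- Rmult_assoc, Rinv_r by lra. lra. }
      apply Rabs_def1; lra. }
    apply Rabs_def2 in Hst.
    destruct (Rle_lt_dec t s).
    + apply E; lra.
    + rewrite Rabs_minus_sym. apply E; lra.
Qed.

(** The two sides are powers of [k] with an odd and an even exponent. This distinguishes orbit
    segments that visit [brk1] from those that do not. *)
Lemma pow_parity k m n : 0 < k < 1 -> k * (k ^ 2) ^ m <> (k ^ 2) ^ n.
Proof.
  intros Hk H. rewrite <- !pow_mult in H. change (k ^ S (2 * m) = k ^ (2 * n)) in H.
  assert (E : forall i j, (i < j)%nat -> k ^ j < k ^ i).
  { intros i j Hij. replace j with (i + S (j - i - 1))%nat by lia. rewrite pow_add.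
    assert (0 < k ^ i) by (apply pow_lt; lra).
    assert (k ^ S (j - i - 1) < 1) by (apply pow_lt_1_compat; [lra|lia]).
    apply (Rmult_lt_compat_l (k ^ i)) in H1; lra. }
  destruct (Nat.lt_trichotomy (S (2 * m)) (2 * n)) as [L|[L|L]]; [|lia|]; apply E in L; lra.
Qed.

Section Centralizer.

Variables k p q : R.
Hypothesis Hk : 0 < k <= 1 / 4.
Hypothesis Hpq : p < q.

Notation beta := (bump k p q).
Let bb : bij beta := bump_bij k p q Hk Hpq.

(** By the chain rule the ratio is the product of the ratios along the orbit. Away from [brk1] each
    factor is [1] or [k ^ 2]. *)
Lemma slope_ratio_zpow_avoid (n : nat) x : p < x < q ->
  (forall i, (0 <= i < Z.of_nat n)%Z -> zpow beta i x <> brk1 k p q) ->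
  exists m, slope_ratio (zpow beta (Z.of_nat n)) x ((k ^ 2) ^ m).
Proof.
  intros Hx. induction n as [|n IH]; intros H.
  - exists 0%nat. eapply (slope_ratio_affine _ x p q 1 0); [lra|easy|].
    intros t _. rewrite zpow_0. ring.
  - destruct IH as [m Hm]; [intros i Hi; apply H; lia|].
    specialize (H (Z.of_nat n) ltac:(lia)).
    set (y := zpow beta (Z.of_nat n) x) in *.
    assert (Hy : p < y < q) by now apply zpow_bump_interval.
    pose proof (slope_ratio_bump k p q Hk Hpq y Hy) as Hr.
    assert (E : zpow beta (Z.of_nat (S n)) = fun t => beta (zpow beta (Z.of_nat n) t)).
    { extensionality t. now rewrite Nat2Z.inj_succ, zpow_succ. }
    rewrite E.
    assert (0 < (k ^ 2) ^ m) by (apply pow_lt, k2_bound, Hk).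
    destruct (Req_dec_T y (brk1 k p q)); [easy|].
    destruct (Req_dec_T y (brk2 k p q)).
    + exists (S m). replace ((k ^ 2) ^ S m) with ((k ^ 2) ^ m * k ^ 2) by (simpl; ring).
      now apply slope_ratio_comp.
    + exists m. rewrite <- (Rmult_1_r ((k ^ 2) ^ m)). now apply slope_ratio_comp.
Qed.

(** Powers of the bump move a point injectively, so [brk1] is visited exactly once. The segments
    before and after time [N] avoid it, and the visit contributes the single odd factor [k]. *)
Lemma slope_ratio_zpow_hit (n N : nat) x : p < x < q -> (N < n)%nat ->
  zpow beta (Z.of_nat N) x = brk1 k p q ->
  exists m, slope_ratio (zpow beta (Z.of_nat n)) x (k * (k ^ 2) ^ m).
Proof.
  intros Hx HN H.
  pose proof (brk_order k p q Hk Hpq) as Ho.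
  assert (Hin : p < brk1 k p q < q) by lra.
  destruct (slope_ratio_zpow_avoid N x Hx) as [m1 H1].
  { intros i Hi. rewrite <- H. intros E. apply zpow_bump_inj in E; try easy. lia. }
  destruct (slope_ratio_zpow_avoid (n - N - 1) (beta (brk1 k p q))) as [m2 H2].
  { now apply bump_interval. }
  { intros i Hi. rewrite <- (zpow_1 beta (brk1 k p q)), <- zpow_add by easy. intros E.
    rewrite <- (zpow_0 beta (brk1 k p q)) in E at 2.
    apply zpow_bump_inj in E; try easy. lia. }
  pose proof (slope_ratio_bump k p q Hk Hpq _ Hin) as H3.
  destruct (Req_dec_T (brk1 k p q) (brk1 k p q)); [|easy].
  rewrite <- H in H2, H3.
  assert (Hp1 : 0 < (k ^ 2) ^ m1) by (apply pow_lt, k2_bound, Hk).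
  pose proof (slope_ratio_comp _ _ _ _ _ Hp1 H1 H3) as H4.
  assert (Hp2 : 0 < (k ^ 2) ^ m1 * k) by (apply Rmult_lt_0_compat; lra).
  pose proof (slope_ratio_comp _ _ _ _ _ Hp2 H4 H2) as H5.
  exists (m1 + m2)%nat. rewrite pow_add.
  replace (k * ((k ^ 2) ^ m1 * (k ^ 2) ^ m2)) with ((k ^ 2) ^ m1 * k * (k ^ 2) ^ m2) by ring.
  replace (zpow beta (Z.of_nat n))
    with (fun t => zpow beta (Z.of_nat (n - N - 1)) (beta (zpow beta (Z.of_nat N) t))); [easy|].
  extensionality t. rewrite <- zpow_succ, <- zpow_add by easy. f_equal. lia.
Qed.

Section Commuting.

Variable c : R -> R.
Hypothesis bc : bij c.
Hypothesis cp : right_affine c p.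
Hypothesis cq : left_affine c q.
Hypothesis cb : comm c beta.

(** The open interval is exactly the set of points moved by the bump, and a commuting permutation
    preserves this set. *)
Lemma commuting_interval t : p < c t < q <-> p < t < q.
Proof.
  assert (E : forall t, p < t < q <-> beta t <> t).
  { intros s. split.
    - intros Hs. pose proof (bump_moves k p q Hk Hpq s Hs). lra.
    - intros Hs. destruct (Rle_lt_dec s p); [now rewrite bump_left in Hs|].
      destruct (Rle_lt_dec q s); [now rewrite bump_right in Hs|]. lra. }
  rewrite !E, <- cb. split; intros H H'; apply H.
  - congruence.
  - now apply (proj1 bc).
Qed.

(** The point [c p] lies outside [(p,q)], while points just to the right of [p] are mapped into it
    by a right-affine map. This leaves only [p] as a value. *)
Lemma commuting_fixes_left : c p = p.
Proof.
  destruct cp as (s & e & Hs & He & H).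
  assert (Hp : ~ p < c p < q) by (rewrite commuting_interval; lra).
  assert (E : forall d, 0 < d < e -> d < q - p -> p < c p + s * d < q).
  { intros d Hd Hd'. replace d with (p + d - p) by ring. rewrite <- H by lra.
    apply commuting_interval. lra. }
  destruct (Rtotal_order (c p) p) as [L|[L|L]]; [|easy|].
  (* With [d] at most [(p - c p) / s], the image [c p + s * d] of [p + d] has not yet passed [p]. *)
  - set (d := Rmin ((p - c p) / s) (Rmin (e / 2) ((q - p) / 2))).
    assert (D1 : d <= (p - c p) / s) by apply Rmin_l.
    assert (D2 : d <= e / 2) by (eapply Rle_trans; [apply Rmin_r|apply Rmin_l]).
    assert (D3 : d <= (q - p) / 2) by (eapply Rle_trans; [apply Rmin_r|apply Rmin_r]).
    assert (0 < d).
    { repeat apply Rmin_glb_lt; try lra. apply Rdiv_lt_0_compat; lra. }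
    specialize (E d ltac:(lra) ltac:(lra)).
    apply (Rmult_le_compat_l s) in D1; [|lra].
    replace (s * ((p - c p) / s)) with (p - c p) in D1 by (field; lra). lra.
  - set (d := Rmin (e / 2) ((q - p) / 2)).
    assert (D2 : d <= e / 2) by apply Rmin_l.
    assert (D3 : d <= (q - p) / 2) by apply Rmin_r.
    assert (0 < d) by (apply Rmin_glb_lt; lra).
    specialize (E d ltac:(lra) ltac:(lra)).
    assert (0 < s * d) by (apply Rmult_lt_0_compat; lra). lra.
Qed.

(* Comparing the one-sided slopes of both sides of [c o beta^n = beta^n o c] at a
   point [x0] with [x0], [beta^n x0] close to the ends of [p,q), where [c] is affine,
   the number of visits to the first breakpoint has to be odd on both orbits. *)
Lemma commuting_orbit : exists z, c (brk1 k p q) = zpow beta z (brk1 k p q).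
Proof.
  pose proof commuting_fixes_left as Hcp.
  destruct cp as (s & e & Hs & He & H). destruct cq as (s' & b' & e' & Hs' & He' & H').
  pose proof (brk_order k p q Hk Hpq) as Ho.
  assert (Hin : p < brk1 k p q < q) by lra.
  set (d := Rmin e (q - p) / 2).
  assert (Rmin e (q - p) <= e) by apply Rmin_l.
  assert (Rmin e (q - p) <= q - p) by apply Rmin_r.
  assert (0 < Rmin e (q - p)) by (apply Rmin_glb_lt; lra).
  set (d' := Rmin e' (q - p) / 2).
  assert (Rmin e' (q - p) <= e') by apply Rmin_l.
  assert (Rmin e' (q - p) <= q - p) by apply Rmin_r.
  assert (0 < Rmin e' (q - p)) by (apply Rmin_glb_lt; lra).
  destruct (bump_escape_down k p q Hk Hpq (p + d) (brk1 k p q)) as (N1 & HN1 & E1);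
    [unfold d; lra|easy|].
  destruct (bump_escape k p q Hk Hpq (brk1 k p q) (q - d')) as (N2 & HN2 & E2);
    [easy|unfold d'; lra|].
  specialize (E1 N1 ltac:(lia)). specialize (E2 (N2 + 1)%Z ltac:(lia)).
  set (x0 := zpow beta (- N1) (brk1 k p q)) in *.
  assert (Hx0 : p < x0 < q) by now apply zpow_bump_interval.
  assert (Hx1 : zpow beta N1 x0 = brk1 k p q) by now apply zpow_opp_r.
  (* The extra [1] puts the visit to [brk1] at time [N1] strictly before time [n], even when
     [N2 = 0]. *)
  set (n := Z.to_nat (N1 + N2 + 1)).
  assert (Hn : zpow beta (Z.of_nat n) x0 = zpow beta (N2 + 1) (brk1 k p q)).
  { rewrite <- Hx1, <- zpow_add by easy. f_equal. lia. }
  assert (Hcx0 : p < c x0 < q) by now apply commuting_interval.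
  assert (K1 : slope_ratio c x0 1).
  { eapply (slope_ratio_affine c x0 p (p + e) s (c p - s * p)); [easy|unfold d in *; lra|].
    intros t Ht. rewrite H by lra. ring. }
  assert (K2 : slope_ratio c (zpow beta (Z.of_nat n) x0) 1).
  { assert (p < zpow beta (Z.of_nat n) x0 < q) by now apply zpow_bump_interval.
    rewrite Hn in *. eapply (slope_ratio_affine c _ (q - e') q s' b'); [easy|unfold d' in *; lra|].
    intros t Ht. apply H'. lra. }
  destruct (slope_ratio_zpow_hit n (Z.to_nat N1) x0 Hx0) as [m K3];
    [lia|now rewrite Z2Nat.id|].
  assert (Hk2 : forall m, 0 < (k ^ 2) ^ m) by (intros; apply pow_lt, k2_bound, Hk).
  pose proof (slope_ratio_comp _ _ _ _ _ (Rmult_lt_0_compat _ _ (proj1 Hk) (Hk2 m)) K3 K2) as K4.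
  destruct (classic (forall i, (0 <= i < Z.of_nat n)%Z -> zpow beta i (c x0) <> brk1 k p q))
    as [C|C].
  - exfalso. destruct (slope_ratio_zpow_avoid n (c x0) Hcx0 C) as [m' K5].
    pose proof (slope_ratio_comp _ _ _ _ _ Rlt_0_1 K1 K5) as K6.
    replace (fun t => zpow beta (Z.of_nat n) (c t)) with (fun t => c (zpow beta (Z.of_nat n) t)) in K6.
    + pose proof (slope_ratio_unique _ _ _ _ K4 K6) as U. rewrite Rmult_1_l, Rmult_1_r in U.
      revert U. apply pow_parity. lra.
    + extensionality t. symmetry. apply comm_zpow; [easy|]. now apply comm_sym.
  - apply not_all_ex_not in C. destruct C as [i C].
    apply imply_to_and in C. destruct C as [_ C]. apply NNPP in C.
    (* Here [brk1] is the [N1]-th iterate of [x0] and the [i]-th iterate of [c x0], and [c] commutes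
       with the iterates. *)
    exists (N1 - i)%Z.
    rewrite <- Hx1 at 1. rewrite <- (comm_zpow beta c N1 bb) by now apply comm_sym.
    rewrite <- C, <- zpow_add by easy. f_equal. lia.
Qed.

(** [c] and a power of the bump agree at [brk1], hence along its orbit, which accumulates at [p].
    Both are affine to the right of their common fixed point [p], so their slopes there are equal.
    Negative powers carry every point of the interval into this neighbourhood, and the agreement
    spreads. *)
Lemma bump_centralizer :
  (forall z, right_affine (zpow beta z) p) ->
  exists z, forall t, p <= t < q -> c t = zpow beta z t.
Proof.
  intros Hz. destruct commuting_orbit as [z E]. exists z.
  pose proof commuting_fixes_left as Hcp.
  pose proof (brk_order k p q Hk Hpq) as Ho.
  assert (Hin : p < brk1 k p q < q) by lra.
  assert (Hzp : zpow beta z p = p) by (apply zpow_bump_outside; lra).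
  destruct cp as (s & e & Hs & He & H). destruct (Hz z) as (s' & e' & Hs' & He' & H').
  rewrite Hcp in H. rewrite Hzp in H'.
  set (d := Rmin (Rmin e e') (q - p) / 2).
  assert (Rmin (Rmin e e') (q - p) <= q - p) by apply Rmin_r.
  assert (Rmin (Rmin e e') (q - p) <= Rmin e e') by apply Rmin_l.
  assert (Rmin e e' <= e) by apply Rmin_l.
  assert (Rmin e e' <= e') by apply Rmin_r.
  assert (0 < Rmin (Rmin e e') (q - p)) by (repeat apply Rmin_glb_lt; lra).
  assert (Esc : forall t, p < t < q -> exists j, p < zpow beta (- j) t < p + d).
  { intros t Ht. destruct (bump_escape_down k p q Hk Hpq (p + d) t) as (N & _ & HN);
      [unfold d; lra|easy|].
    exists N. split; [|apply HN; lia]. now apply zpow_bump_interval. }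
  assert (Hcz : forall j t, c (zpow beta j t) = zpow beta j (c t)).
  { intros. symmetry. apply comm_zpow; [easy|]. now apply comm_sym. }
  assert (Hzz : forall i j t, zpow beta i (zpow beta j t) = zpow beta j (zpow beta i t)).
  { intros. rewrite <- !zpow_add by easy. f_equal. lia. }
  assert (Hss : s = s').
  { destruct (Esc _ Hin) as [j Hj]. set (y := zpow beta (- j) (brk1 k p q)) in *.
    assert (F : c y = zpow beta z y) by (unfold y; now rewrite Hcz, Hzz, E).
    unfold d in *. rewrite H, H' in F by lra.
    apply (Rmult_eq_reg_r (y - p)); lra. }
  subst s'. intros t Ht. destruct (Req_dec_T t p) as [->|Ht']; [congruence|].
  destruct (Esc t ltac:(lra)) as [j Hj].
  rewrite <- (zpow_opp_r beta j t bb), Hcz, Hzz. f_equal.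
  unfold d in *. now rewrite H, H' by lra.
Qed.

End Commuting.

End Centralizer.

(** * Moments of finitely supported integer sequences *)

Section Sums.

Local Open Scope Z_scope.

Definition finitely_supported (f : Z -> Z) : Prop :=
  exists K, 0 <= K /\ forall i, K < Z.abs i -> f i = 0.

(** The sum runs over the symmetric window from [-n] to [n]. For a finitely supported sequence it is
    eventually constant, so total sums are handled by statements about all large [n]. *)
Fixpoint zsum (f : Z -> Z) (n : nat) : Z :=
  match n with
  | O => f 0
  | S n' => zsum f n' + f (Z.of_nat n) + f (- Z.of_nat n)
  end.

(** The coefficients of the monomial [X^l]. *)
Definition delta (l i : Z) : Z := if i =? l then 1 else 0.

Lemma zsum_ext f g n : (forall i, f i = g i) -> zsum f n = zsum g n.
Proof. intros H. induction n as [|n IH]; cbn [zsum]; now rewrite ?IH, !H. Qed.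

Lemma zsum_add f g n : zsum (fun i => f i + g i) n = zsum f n + zsum g n.
Proof. induction n as [|n IH]; cbn [zsum]; [easy|]. rewrite IH. ring. Qed.

Lemma zsum_scal c f n : zsum (fun i => c * f i) n = c * zsum f n.
Proof. induction n as [|n IH]; cbn [zsum]; [easy|]. rewrite IH. ring. Qed.

Lemma zsum_shift1 f n :
  zsum (fun i => f (i - 1)) n = zsum f n + f (- Z.of_nat n - 1) - f (Z.of_nat n).
Proof.
  induction n as [|n IH]; cbn [zsum]; [simpl; ring|]. rewrite IH.
  replace (Z.of_nat (S n) - 1) with (Z.of_nat n) by lia.
  replace (- Z.of_nat (S n)) with (- Z.of_nat n - 1) by lia. ring.
Qed.

(** Each unit translation changes the sum only by two boundary terms, which vanish once the window
    exceeds the support by more than the translation. *)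
Lemma zsum_shift f (m : nat) : finitely_supported f ->
  exists N, forall n, (N <= n)%nat -> zsum (fun i => f (i - Z.of_nat m)) n = zsum f n.
Proof.
  intros (K & HK & H). induction m as [|m [N IH]].
  - exists 0%nat. intros n _. apply zsum_ext. intros i. f_equal. lia.
  - exists (N + Z.to_nat K + m + 1)%nat. intros n Hn. rewrite <- IH by lia.
    rewrite (zsum_ext _ (fun i => f (i - 1 - Z.of_nat m))) by (intros; f_equal; lia).
    rewrite (zsum_shift1 (fun i => f (i - Z.of_nat m))), !H by lia. ring.
Qed.

Lemma zsum_point (g : Z -> Z) l n : Z.abs l <= Z.of_nat n ->
  zsum (fun i => g i * delta l i) n = g l.
Proof.
  intros Hl.
  assert (E : forall n, zsum (fun i => g i * delta l i) n =
    if Z.abs l <=? Z.of_nat n then g l else 0).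
  { clear n Hl. unfold delta. induction n as [|n IH]; cbn [zsum].
    - destruct (Z.eqb_spec 0 l), (Z.leb_spec (Z.abs l) (Z.of_nat 0)); subst; lia.
    - rewrite IH.
      destruct (Z.eqb_spec (Z.of_nat (S n)) l), (Z.eqb_spec (- Z.of_nat (S n)) l),
        (Z.leb_spec (Z.abs l) (Z.of_nat n)), (Z.leb_spec (Z.abs l) (Z.of_nat (S n)));
        subst; lia. }
  rewrite E. destruct (Z.leb_spec (Z.abs l) (Z.of_nat n)); lia.
Qed.

(* Compare first moments of both sides of the hypothesis. *)
Lemma first_moment h (m : nat) l : finitely_supported h ->
  (forall i, h (i - Z.of_nat m) + delta 0 i = delta l i + h i) ->
  exists N, forall n, (N <= n)%nat -> Z.of_nat m * zsum h n = l.
Proof.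
  intros (K & HK & H) E.
  (* The translate of [g] by [m] is [i * h (i - m)], so translation invariance compares this sum
     with that of [(i + m) * h i]. Multiplying the hypothesis by [i] also removes the term
     [delta 0 i]. *)
  set (g := fun i => (i + Z.of_nat m) * h i).
  destruct (zsum_shift g m) as [N HN].
  { exists K. split; [easy|]. intros i Hi. unfold g. rewrite H by easy. ring. }
  exists (N + Z.to_nat (Z.abs l))%nat. intros n Hn. specialize (HN n ltac:(lia)).
  rewrite (zsum_ext g (fun i => i * h i + Z.of_nat m * h i)) in HN
    by (intros; unfold g; ring).
  rewrite (zsum_ext _ (fun i => i * h i + i * delta l i)) in HN.
  - rewrite !zsum_add, zsum_scal, (zsum_point (fun i => i)) in HN by lia. lia.
  - intros i. unfold g. replace (i - Z.of_nat m + Z.of_nat m) with i by ring.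
    specialize (E i). unfold delta in *.
    destruct (Z.eqb_spec i 0), (Z.eqb_spec i l); subst; lia || nia.
Qed.

(** First moments give total sum [n] for [v], and [m] times the total sum of [w] equals [l]. Summing
    the last identity cancels [u] and equates the two total sums. *)
Lemma moments_mul (m n l : nat) v w u :
  finitely_supported v -> finitely_supported w -> finitely_supported u ->
  (forall i, v (i - 1) + delta 0 i = delta (Z.of_nat n) i + v i) ->
  (forall i, w (i - Z.of_nat m) + delta 0 i = delta (Z.of_nat l) i + w i) ->
  (forall i, u (i - 1) + v i = w i + u i) -> l = (m * n)%nat.
Proof.
  intros Fv Fw Fu Ev Ew Eu.
  destruct (first_moment v 1 _ Fv Ev) as [N1 H1].
  destruct (first_moment w m _ Fw Ew) as [N2 H2].
  destruct (zsum_shift u 1 Fu) as [N3 H3].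
  set (N := (N1 + N2 + N3)%nat).
  specialize (H1 N ltac:(lia)). specialize (H2 N ltac:(lia)). specialize (H3 N ltac:(lia)).
  assert (E : zsum (fun i => u (i - 1) + v i) N = zsum (fun i => w i + u i) N)
    by now apply zsum_ext.
  rewrite !zsum_add in E. change (Z.of_nat 1) with 1 in H3.
  assert (zsum v N = zsum w N) by lia. nia.
Qed.

End Sums.

(** * The wreath product inside the group *)

Section Group.

Variables (r k : R) (G : (R -> R) -> Prop).
Hypothesis Hr : 0 < r.
Hypothesis Hk : 0 < k <= 1 / 4.
Hypothesis HG : subgroupV r G.

(** The interval from [pivot] to [shift pivot] is a fundamental domain of [shift] on [(0,r)]. A
    breakpoint is chosen because it and its image lie in [A], as is required of the ends of [gen]
    and [low_bump]. *)
Definition pivot : R := brk1 k 0 r.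
Definition shift : R -> R := bump k 0 r.
Definition gen : R -> R := bump k pivot (shift pivot).
Definition low_bump : R -> R := bump k 0 pivot.

Hypothesis Gsh : G shift.
Hypothesis Ggen : G gen.
Hypothesis Glow : G low_bump.

Lemma G_bij f : G f -> bij f.
Proof. intros Hf. eapply Vel_bij. now apply HG. Qed.

Lemma G_right_affine f x : G f -> 0 <= x < r -> right_affine f x.
Proof. intros Hf. apply (Vel_right_affine r posR allR); [easy|]. now apply HG. Qed.

Lemma G_left_affine f x : G f -> 0 < x <= r -> left_affine f x.
Proof. intros Hf. apply (Vel_left_affine r posR allR); [easy|]. now apply HG. Qed.

Lemma G_gmul f g : G f -> G g -> G (gmul f g).
Proof. apply HG. Qed.

Lemma G_finv f : G f -> G (finv f).
Proof. apply HG. Qed.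

Lemma G_idf : G idf.
Proof. apply HG. Qed.

Lemma G_zpow f z : G f -> G (zpow f z).
Proof.
  intros Hf. pose proof (G_bij f Hf) as bf. induction z using Z.peano_ind.
  - exact G_idf.
  - replace (zpow f (Z.succ z)) with (gmul (zpow f z) f); [now apply G_gmul|].
    extensionality t. now rewrite zpow_succ.
  - replace (zpow f (Z.pred z)) with (gmul (zpow f z) (finv f)).
    + apply G_gmul; [easy|now apply G_finv].
    + extensionality t. now rewrite zpow_pred.
Qed.

Lemma bij_shift : bij shift.
Proof. now apply G_bij. Qed.

Lemma bij_gen : bij gen.
Proof. now apply G_bij. Qed.

Local Hint Resolve bij_shift bij_gen : core.

Lemma pivot_order : 0 < pivot < shift pivot /\ shift pivot < r.
Proof.
  pose proof (brk_order k 0 r Hk Hr). fold pivot in H.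
  pose proof (bump_moves k 0 r Hk Hr pivot ltac:(lra)). fold shift in H0.
  pose proof (proj2 (bump_interval k 0 r Hk pivot) ltac:(lra)). fold shift in H1. lra.
Qed.

Lemma shift_interval z t : 0 < t < r -> 0 < zpow shift z t < r.
Proof. now apply (zpow_bump_interval k 0 r Hk Hr). Qed.

Lemma shift_mono z s t : zpow shift z s < zpow shift z t <-> s < t.
Proof. apply increasing_iff, increasing_zpow; [easy|]. now apply bump_increasing. Qed.

Lemma shift_mono_le z s t : zpow shift z s <= zpow shift z t <-> s <= t.
Proof. apply increasing_le_iff, increasing_zpow; [easy|]. now apply bump_increasing. Qed.

Lemma shift_le z w : (z <= w)%Z -> zpow shift z pivot <= zpow shift w pivot.
Proof. apply (zpow_bump_le k 0 r Hk Hr). pose proof pivot_order. lra. Qed.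

Lemma zpow_shift_inj z w : zpow shift z = zpow shift w -> z = w.
Proof.
  intros H. apply (zpow_bump_inj k 0 r Hk Hr z w pivot); [pose proof pivot_order; lra|].
  fold shift. now rewrite H.
Qed.

Lemma shift_next z : zpow shift z (shift pivot) = zpow shift (z + 1) pivot.
Proof. now rewrite zpow_add. Qed.

Lemma gen_interval z t : pivot <= t < shift pivot -> pivot <= zpow gen z t < shift pivot.
Proof.
  intros Ht. pose proof pivot_order. destruct (Req_dec_T t pivot) as [->|N].
  - unfold gen. rewrite zpow_bump_outside; lra.
  - pose proof (proj2 (zpow_bump_interval k pivot (shift pivot) Hk ltac:(lra) z t) ltac:(lra)) as E.
    fold gen in E. lra.
Qed.

(** The centralizer theorem applies on all of [[0,r)], and elements of [G] are the identity
    elsewhere. *)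
Lemma shift_centralizer x : G x -> comm x shift -> exists z, x = zpow shift z.
Proof.
  intros Hx Hc.
  destruct (bump_centralizer k 0 r Hk Hr x) as [z Hz].
  - now apply G_bij.
  - apply G_right_affine; [easy|lra].
  - apply G_left_affine; [easy|lra].
  - easy.
  - intros z. apply G_right_affine; [now apply G_zpow|lra].
  - exists z. extensionality t.
    destruct (Rle_lt_dec 0 t), (Rlt_le_dec t r).
    + now apply Hz.
    + unfold shift. rewrite zpow_bump_outside by lra. apply HG; [easy|lra].
    + unfold shift. rewrite zpow_bump_outside by lra. apply HG; [easy|lra].
    + lra.
Qed.

(** On the base group this is multiplication by [X^i]: it carries the action of [w] on one
    fundamental domain to the domain [i] places further. The conjugate [gen_at i] of [gen]
    corresponds to the monomial [X^i]. *)
Definition conj_shift (i : Z) (w : R -> R) : R -> R := fun t => zpow shift i (w (zpow shift (- i) t)).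

Lemma G_conj_shift i w : G w -> G (conj_shift i w).
Proof.
  intros Hw. change (conj_shift i w) with (gmul (zpow shift (- i)) (gmul w (zpow shift i))).
  apply G_gmul; [now apply G_zpow|]. apply G_gmul; [easy|now apply G_zpow].
Qed.

Lemma conj_shift_gmul i f g t : conj_shift i (fun s => f (g s)) t = conj_shift i f (conj_shift i g t).
Proof. unfold conj_shift. now rewrite zpow_opp_l. Qed.

Lemma conj_shift_conj_shift i j w t : conj_shift i (conj_shift j w) t = conj_shift (i + j) w t.
Proof.
  unfold conj_shift. rewrite <- !zpow_add by easy. repeat f_equal. lia.
Qed.

Lemma comm_conj_shift i f g : comm f g -> comm (conj_shift i f) (conj_shift i g).
Proof. intros H t. unfold conj_shift. now rewrite !zpow_opp_l, H. Qed.

Definition gen_at (i : Z) : R -> R := conj_shift i gen.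

Lemma gen_at_moves i t : gen_at i t <> t <-> zpow shift i pivot < t < zpow shift (i + 1) pivot.
Proof.
  pose proof pivot_order as Ho. rewrite <- shift_next. unfold gen_at, conj_shift.
  set (s := zpow shift (- i) t). replace t with (zpow shift i s) by now apply zpow_opp_r.
  rewrite !shift_mono.
  split; intros H.
  - destruct (Rle_lt_dec s pivot).
    { exfalso. apply H. unfold gen. now rewrite bump_left. }
    destruct (Rle_lt_dec (shift pivot) s); [|easy].
    exfalso. apply H. unfold gen. now rewrite bump_right.
  - intros E. apply (proj1 (bij_zpow shift i bij_shift)) in E.
    pose proof (bump_moves k pivot (shift pivot) Hk ltac:(lra) s H). fold gen in H0. lra.
Qed.

Lemma G_gen_at i : G (gen_at i).
Proof. now apply G_conj_shift. Qed.

Lemma comm_gen_at i j : comm (gen_at i) (gen_at j).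
Proof.
  destruct (Z.eq_dec i j) as [->|N]; [now intros t|].
  apply comm_disjoint; try apply G_bij, G_gen_at.
  intros t. apply NNPP. intros H. apply not_or_and in H. destruct H as [H1 H2].
  apply gen_at_moves in H1, H2.
  destruct (Z.lt_ge_cases i j) as [L|L].
  - pose proof (shift_le (i + 1) j ltac:(lia)). lra.
  - pose proof (shift_le (j + 1) i ltac:(lia)). lra.
Qed.

(** For [i >= 0] the supports are disjoint. For [i < 0] the support of [gen_at i] lies inside that
    of [low_bump]; commuting would make it a power of [low_bump] there, but it fixes some points of
    [(0,pivot)] and moves others. *)
Lemma gen_at_low i : comm (gen_at i) low_bump <-> (0 <= i)%Z.
Proof.
  pose proof pivot_order as Ho. split; intros H.
  - apply Z.nlt_ge. intros Hi.
    assert (Hi1 : zpow shift (i + 1) pivot <= pivot).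
    { rewrite <- (zpow_0 shift pivot) at 2. apply shift_le. lia. }
    assert (Hi0 : 0 < zpow shift i pivot) by (apply shift_interval; lra).
    assert (Hi2 : zpow shift i pivot < zpow shift (i + 1) pivot).
    { rewrite <- shift_next. now apply shift_mono. }
    destruct (bump_centralizer k 0 pivot Hk ltac:(lra) (gen_at i)) as [z Hz].
    + apply G_bij, G_gen_at.
    + apply G_right_affine; [apply G_gen_at|lra].
    + apply G_left_affine; [apply G_gen_at|lra].
    + easy.
    + intros z. apply G_right_affine; [now apply G_zpow|lra].
    + fold low_bump in Hz.
      (* This point lies below the support of [gen_at i]. Since only the zeroth power of [low_bump]
         fixes a point of [(0,pivot)], it forces [z = 0]. *)
      assert (E : gen_at i (zpow shift i pivot / 2) = zpow shift i pivot / 2).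
      { apply NNPP. intros E. apply gen_at_moves in E. lra. }
      rewrite Hz in E by lra. rewrite <- (zpow_0 low_bump (zpow shift i pivot / 2)) in E at 2.
      apply zpow_bump_inj in E; [|easy|lra|lra]. subst z.
      assert (F : gen_at i ((zpow shift i pivot + zpow shift (i + 1) pivot) / 2)
                  <> (zpow shift i pivot + zpow shift (i + 1) pivot) / 2).
      { apply gen_at_moves. lra. }
      apply F. now rewrite Hz by lra.
  - apply comm_disjoint; [apply G_bij, G_gen_at|now apply G_bij|].
    intros t. destruct (Rle_lt_dec t (zpow shift i pivot)).
    + left. apply NNPP. intros E. apply gen_at_moves in E. lra.
    + right. apply bump_right; [easy|].
      assert (zpow shift 0 pivot <= zpow shift i pivot) by now apply shift_le. rewrite zpow_0 in *. lra.
Qed.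

(** * The base group and its coordinates *)

Definition in_base (w : R -> R) : Prop := G w /\ forall i, comm w (gen_at i).

(** [w] acts on the [i]-th fundamental domain of [shift] as the [h i]-th power of
    the conjugate of [gen] supported there. *)
Definition coords (w : R -> R) (h : Z -> Z) : Prop :=
  forall i t, pivot <= t < shift pivot -> w (zpow shift i t) = zpow shift i (zpow gen (h i) t).

Lemma coords_unique w h h' : coords w h -> coords w h' -> forall i, h i = h' i.
Proof.
  intros H H' i. pose proof pivot_order.
  apply (zpow_bump_inj k pivot (shift pivot) Hk ltac:(lra) _ _ ((pivot + shift pivot) / 2)); [lra|].
  apply (proj1 (bij_zpow shift i bij_shift)). fold gen. rewrite <- H, <- H' by lra. easy.
Qed.

Lemma coords_mul f g h h' : coords f h -> coords g h' ->
  coords (fun t => f (g t)) (fun i => h i + h' i)%Z.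
Proof.
  intros H H' i t Ht. rewrite H' by easy. rewrite H by now apply gen_interval.
  now rewrite zpow_add.
Qed.

Lemma coords_conj_shift m w h : coords w h -> coords (conj_shift m w) (fun i => h (i - m)%Z).
Proof.
  intros H i t Ht. unfold conj_shift. rewrite <- zpow_add by easy.
  replace (- m + i)%Z with (i - m)%Z by ring. rewrite H by easy.
  rewrite <- zpow_add by easy. f_equal. ring.
Qed.

Lemma coords_gen_at j : coords (gen_at j) (delta j).
Proof.
  intros i t Ht. unfold delta. destruct (Z.eqb_spec i j) as [->|N].
  - unfold gen_at, conj_shift. now rewrite zpow_opp_l.
  - rewrite zpow_0. apply NNPP. intros E. apply gen_at_moves in E.
    assert (zpow shift i pivot <= zpow shift i t) by now apply shift_mono_le.
    assert (zpow shift i t < zpow shift (i + 1) pivot) by (rewrite <- shift_next; now apply shift_mono).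
    destruct (Z.lt_ge_cases i j) as [L|L].
    + pose proof (shift_le (i + 1) j ltac:(lia)). lra.
    + pose proof (shift_le (j + 1) i ltac:(lia)). lra.
Qed.

Lemma coords_gen : coords gen (delta 0).
Proof. exact (coords_gen_at 0). Qed.

Lemma coords_trivial w h i : coords w h ->
  (forall t, zpow shift i pivot < t < zpow shift (i + 1) pivot -> w t = t) -> h i = 0%Z.
Proof.
  intros H E. pose proof pivot_order as Ho. set (t := (pivot + shift pivot) / 2).
  assert (Ht : pivot < t < shift pivot) by (unfold t; lra).
  apply (zpow_bump_inj k pivot (shift pivot) Hk ltac:(lra) _ _ t Ht).
  apply (proj1 (bij_zpow shift i bij_shift)). fold gen. rewrite <- H by lra.
  rewrite zpow_0. apply E. rewrite <- shift_next. now rewrite !shift_mono.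
Qed.

Lemma coords_fixes w h i : coords w h -> w (zpow shift i pivot) = zpow shift i pivot.
Proof.
  intros H. pose proof pivot_order. rewrite H by lra. unfold gen.
  now rewrite zpow_bump_outside by lra.
Qed.

Lemma affine_fixing_two s b x y : s * x + b = x -> s * y + b = y -> x <> y -> s = 1 /\ b = 0.
Proof.
  intros Hx Hy N. assert (s = 1) by (apply (Rmult_eq_reg_r (x - y)); lra).
  subst s. split; [easy|lra].
Qed.

(** The ends of the fundamental domains are fixed by [w] and accumulate at [0] and [r], near which
    [w] is affine. An affine map with two fixed points is the identity, so coordinates far out
    vanish. *)
Lemma coords_finite w h : G w -> coords w h -> finitely_supported h.
Proof.
  intros Gw H. pose proof pivot_order as Ho.
  destruct (G_right_affine w 0 Gw ltac:(lra)) as (s & e & Hs & He & E).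
  destruct (G_left_affine w r Gw ltac:(lra)) as (s' & b' & e' & Hs' & He' & E').
  set (d := Rmin e r / 2).
  assert (Rmin e r <= e) by apply Rmin_l. assert (Rmin e r <= r) by apply Rmin_r.
  assert (0 < Rmin e r) by (apply Rmin_glb_lt; lra).
  set (d' := Rmin e' r / 2).
  assert (Rmin e' r <= e') by apply Rmin_l. assert (Rmin e' r <= r) by apply Rmin_r.
  assert (0 < Rmin e' r) by (apply Rmin_glb_lt; lra).
  assert (Hin : forall i, 0 < zpow shift i pivot < r) by (intros; apply shift_interval; lra).
  assert (Hne : forall i, zpow shift i pivot <> zpow shift (i + 1) pivot).
  { intros i. rewrite <- shift_next. pose proof (proj2 (shift_mono i pivot (shift pivot))). lra. }
  destruct (bump_escape_down k 0 r Hk Hr d pivot) as (N & HN & F); [unfold d; lra|lra|].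
  destruct (bump_escape k 0 r Hk Hr pivot (r - d')) as (N' & HN' & F'); [lra|unfold d'; lra|].
  fold shift in F, F'.
  exists (N + N' + 2)%Z. split; [lia|]. intros i Hi.
  destruct (Z.lt_ge_cases i 0) as [L|L].
  - assert (B : forall j, (j <= i + 1)%Z -> zpow shift j pivot < d).
    { intros j Hj. replace j with (- (- j))%Z by ring. apply F. lia. }
    destruct (affine_fixing_two s (w 0) (zpow shift i pivot) (zpow shift (i + 1) pivot)) as [-> E0].
    + pose proof (coords_fixes w h i H). pose proof (Hin i). pose proof (B i ltac:(lia)).
      rewrite E in H6 by (unfold d in *; lra). lra.
    + pose proof (coords_fixes w h (i + 1) H). pose proof (Hin (i + 1)%Z).
      pose proof (B (i + 1)%Z ltac:(lia)).
      rewrite E in H6 by (unfold d in *; lra). lra.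
    + apply Hne.
    + apply (coords_trivial w); [easy|]. intros t Ht.
      pose proof (Hin i). pose proof (B (i + 1)%Z ltac:(lia)).
      rewrite E by (unfold d in *; lra). lra.
  - assert (B : forall j, (i <= j)%Z -> r - d' < zpow shift j pivot) by (intros; apply F'; lia).
    destruct (affine_fixing_two s' b' (zpow shift i pivot) (zpow shift (i + 1) pivot)) as [-> ->].
    + pose proof (coords_fixes w h i H). pose proof (Hin i). pose proof (B i ltac:(lia)).
      rewrite E' in H6 by (unfold d' in *; lra). lra.
    + pose proof (coords_fixes w h (i + 1) H). pose proof (Hin (i + 1)%Z).
      pose proof (B (i + 1)%Z ltac:(lia)).
      rewrite E' in H6 by (unfold d' in *; lra). lra.
    + apply Hne.
    + apply (coords_trivial w); [easy|]. intros t Ht.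
      pose proof (Hin (i + 1)%Z). pose proof (B i ltac:(lia)).
      rewrite E' by (unfold d' in *; lra). lra.
Qed.

(** Conjugation by a power of [shift] brings the [i]-th domain to the support of [gen], where
    commuting with [gen] forces a power of [gen]. *)
Lemma base_coords w : in_base w -> exists h, coords w h /\ finitely_supported h.
Proof.
  intros [Gw Hw]. pose proof pivot_order as Ho.
  assert (E : forall i, exists z, forall t, pivot <= t < shift pivot -> conj_shift (- i) w t = zpow gen z t).
  { intros i. assert (Gc : G (conj_shift (- i) w)) by now apply G_conj_shift.
    apply bump_centralizer; [easy|lra|now apply G_bij| | | |].
    - apply G_right_affine; [easy|lra].
    - apply G_left_affine; [easy|lra].
    - intros t. pose proof (comm_conj_shift (- i) _ _ (Hw i) t) as C.
      unfold gen_at in C. rewrite !conj_shift_conj_shift in C. now rewrite Z.add_opp_diag_l in C.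
    - intros z. apply G_right_affine; [now apply G_zpow|lra]. }
  set (h := fun i => proj1_sig (constructive_indefinite_description _ (E i))).
  assert (H : coords w h).
  { intros i t Ht. unfold h. destruct constructive_indefinite_description as [z Hz]. simpl.
    rewrite <- Hz by easy. unfold conj_shift. now rewrite Z.opp_involutive, zpow_opp_r. }
  exists h. split; [easy|]. now apply (coords_finite w).
Qed.

Lemma base_gen_at i : in_base (gen_at i).
Proof. split; [apply G_gen_at|]. intros j. apply comm_gen_at. Qed.

Lemma base_mul f g : in_base f -> in_base g -> in_base (fun t => f (g t)).
Proof.
  intros [Gf Hf] [Gg Hg]. split.
  - now apply (G_gmul g f).
  - intros i. now apply (comm_gmul g f).
Qed.

Lemma base_finv f : in_base f -> in_base (finv f).
Proof.
  intros [Gf Hf]. split; [now apply G_finv|]. intros i. apply comm_finv; [now apply G_bij|easy].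
Qed.

Lemma base_conj_shift i f : in_base f -> in_base (conj_shift i f).
Proof.
  intros [Gf Hf]. split; [now apply G_conj_shift|]. intros j.
  pose proof (comm_conj_shift i _ _ (Hf (j - i)%Z)) as C. intros t. specialize (C t).
  unfold gen_at in C. rewrite !conj_shift_conj_shift in C. now replace (i + (j - i))%Z with j in C by ring.
Qed.

(** The Laurent polynomial [1 + X^m + ... + X^(m(n-1))], the quotient of [X^(mn) - 1] by [X^m - 1]
    when [m > 0]. *)
Fixpoint progression (m n : nat) : R -> R :=
  match n with
  | O => idf
  | S n' => fun t => gen_at (Z.of_nat (m * n')) (progression m n' t)
  end.

Lemma base_progression m n : in_base (progression m n).
Proof.
  induction n as [|n IH].
  - split; [apply G_idf|]. now intros i t.
  - simpl. apply (base_mul (gen_at _)); [apply base_gen_at|easy].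
Qed.

Lemma comm_progression m n f : (forall i, comm f (gen_at i)) -> comm f (progression m n).
Proof.
  intros H. induction n as [|n IH]; intros t; [easy|]. simpl. now rewrite (H _ _), IH.
Qed.

(** Telescoping: with [P] the progression, [1 + X^m P = P + X^(mn)], written multiplicatively. *)
Lemma progression_shift m n t :
  gen (conj_shift (Z.of_nat m) (progression m n) t) = progression m n (gen_at (Z.of_nat (m * n)) t).
Proof.
  revert t. induction n as [|n IH]; intros t.
  - rewrite Nat.mul_0_r. unfold conj_shift, idf. simpl progression. unfold idf.
    now rewrite zpow_opp_r.
  - simpl progression. rewrite (conj_shift_gmul _ (gen_at _) (progression m n)).
    unfold gen_at at 1. rewrite conj_shift_conj_shift.
    replace (Z.of_nat m + Z.of_nat (m * n))%Z with (Z.of_nat (m * S n)) by lia.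
    change (conj_shift ?i gen) with (gen_at i). change gen with (gen_at 0) at 1.
    rewrite (comm_gen_at 0 _ _). change (gen_at 0) with gen. rewrite IH.
    destruct (base_progression m n) as [_ C].
    now rewrite <- !(C _ _), (comm_gen_at _ _ _).
Qed.

(** [X^j - X^i] is divisible by [X - 1]; the quotient is the difference of the progressions of
    lengths [j] and [i] with step [1]. *)
Lemma gen_at_cobound (i j : nat) : exists w, in_base w /\
  forall t, gen_at (Z.of_nat i) (conj_shift 1 w t) = w (gen_at (Z.of_nat j) t).
Proof.
  set (v := progression 1 i). set (w := progression 1 j).
  assert (Bv : in_base v) by apply base_progression. assert (Bw : in_base w) by apply base_progression.
  assert (bv : bij v) by now apply G_bij, Bv.
  assert (Ev : forall t, gen (conj_shift 1 v t) = v (gen_at (Z.of_nat i) t)).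
  { intros t. pose proof (progression_shift 1 i t) as E. now rewrite Nat.mul_1_l in E. }
  assert (Ew : forall t, gen (conj_shift 1 w t) = w (gen_at (Z.of_nat j) t)).
  { intros t. pose proof (progression_shift 1 j t) as E. now rewrite Nat.mul_1_l in E. }
  assert (C : comm v w) by now apply comm_progression, Bv.
  assert (C' : comm (conj_shift 1 v) (conj_shift 1 w)) by now apply comm_conj_shift.
  exists (fun t => w (finv v t)). split; [now apply base_mul; [|apply base_finv]|].
  intros t. rewrite (conj_shift_gmul 1 w (finv v)). set (s := conj_shift 1 (finv v) t).
  assert (Ht : t = conj_shift 1 v s).
  { unfold s. rewrite <- (conj_shift_gmul 1 v (finv v)). unfold conj_shift. rewrite finvr by easy.
    now rewrite zpow_opp_r. }
  apply (proj1 bv). rewrite <- Ev, (C' s), C, finvr, <- Ht by easy.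
  now rewrite Ew.
Qed.

(** In the base group, viewed as the module of Laurent polynomials over the
    integers, [v (X - 1) = X^n - 1], [w (X^m - 1) = X^l - 1] and
    [u (X - 1) = w - v]; evaluating quotients at [X = 1] gives [l = m n]. *)
Definition mul_witness (m n l : Z) (v w u : R -> R) : Prop :=
  (forall t, gen (conj_shift 1 v t) = v (gen_at n t)) /\
  (forall t, gen (conj_shift m w t) = w (gen_at l t)) /\
  (forall t, v (conj_shift 1 u t) = u (w t)).

(** Both [v] and [w] are progressions with [n] terms. Passing from [n] to [n + 1] adds
    [X^(mn) - X^n] to [w - v], so [u] is assembled from the quotients of these binomials by
    [X - 1]. *)
Lemma mul_complete (m n : nat) : exists v w u, in_base v /\ in_base w /\ in_base u /\
  mul_witness (Z.of_nat m) (Z.of_nat n) (Z.of_nat (m * n)) v w u.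
Proof.
  exists (progression 1 n), (progression m n).
  assert (E : exists u, in_base u /\
    forall t, progression 1 n (conj_shift 1 u t) = u (progression m n t)).
  { induction n as [|n (u & Bu & Hu)].
    - exists idf. split; [exact (base_progression 0 0)|]. intros t.
      unfold conj_shift. simpl. unfold idf. now rewrite zpow_opp_r.
    - destruct (gen_at_cobound n (m * n)) as (w & Bw & Hw).
      exists (fun t => w (u t)). split; [now apply base_mul|]. intros t.
      rewrite (conj_shift_gmul 1 w u). simpl progression. rewrite Nat.add_0_r.
      rewrite <- (comm_progression 1 n (conj_shift 1 w)) by now apply base_conj_shift.
      rewrite Hw, Hu. now rewrite (proj2 Bu _ _). }
  destruct E as (u & Bu & Hu). exists u.
  repeat (split; [try apply base_progression; easy|]).
  split; [|split; [|easy]].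
  - intros t. pose proof (progression_shift 1 n t) as E. now rewrite Nat.mul_1_l in E.
  - intros t. apply progression_shift.
Qed.

(** Coordinates are unique and additive, so the three group identities become the coefficient
    identities of [moments_mul]. *)
Lemma mul_sound (m n l : nat) v w u : in_base v -> in_base w -> in_base u ->
  mul_witness (Z.of_nat m) (Z.of_nat n) (Z.of_nat l) v w u -> l = (m * n)%nat.
Proof.
  intros Bv Bw Bu (Ev & Ew & Eu).
  destruct (base_coords v Bv) as (hv & Cv & Fv).
  destruct (base_coords w Bw) as (hw & Cw & Fw).
  destruct (base_coords u Bu) as (hu & Cu & Fu).
  apply (moments_mul m n l hv hw hu); try easy; intros i.
  - rewrite Z.add_comm, (Z.add_comm _ (hv i)).
    apply (coords_unique (fun t => gen (conj_shift 1 v t)) (fun i => delta 0 i + hv (i - 1))%Z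
             (fun i => hv i + delta (Z.of_nat n) i)%Z).
    + apply coords_mul; [apply coords_gen|now apply coords_conj_shift].
    + replace (fun t => gen (conj_shift 1 v t)) with (fun t => v (gen_at (Z.of_nat n) t))
        by (extensionality t; now rewrite Ev).
      apply coords_mul; [easy|apply coords_gen_at].
  - rewrite Z.add_comm, (Z.add_comm _ (hw i)).
    apply (coords_unique (fun t => gen (conj_shift (Z.of_nat m) w t))
             (fun i => delta 0 i + hw (i - Z.of_nat m))%Z
             (fun i => hw i + delta (Z.of_nat l) i)%Z).
    + apply coords_mul; [apply coords_gen|now apply coords_conj_shift].
    + replace (fun t => gen (conj_shift (Z.of_nat m) w t)) with (fun t => w (gen_at (Z.of_nat l) t))
        by (extensionality t; now rewrite Ew).
      apply coords_mul; [easy|apply coords_gen_at].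
  - rewrite Z.add_comm, (Z.add_comm _ (hu i)).
    apply (coords_unique (fun t => v (conj_shift 1 u t)) (fun i => hv i + hu (i - 1))%Z
             (fun i => hu i + hw i)%Z).
    + apply coords_mul; [easy|now apply coords_conj_shift].
    + replace (fun t => v (conj_shift 1 u t)) with (fun t => u (w t))
        by (extensionality t; now rewrite Eu).
      now apply coords_mul.
Qed.

(** * Translation of arithmetical formulas *)

Lemma upd_same {X : Type} (env : nat -> X) v a : upd env v a v = a.
Proof. unfold upd. now rewrite Nat.eqb_refl. Qed.

Lemma upd_other {X : Type} (env : nat -> X) v a w : w <> v -> upd env v a w = env w.
Proof. intros H. unfold upd. now apply Nat.eqb_neq in H as ->. Qed.

Ltac simpl_upd := repeat (rewrite upd_same || rewrite upd_other by lia).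

Definition comm_form (x y : gterm) : gform := GEq (GMul x y) (GMul y x).

(** Maps act on the right, so this product applies the inverse of [x] first, and it evaluates to
    [conj_shift i] when [x] is the [i]-th power of [shift]. *)
Definition conj_term (w x : nat) : gterm := GMul (GInv (GVar x)) (GMul (GVar w) (GVar x)).

(** Variables [N], [N+1], [N+2] hold the parameters, variables [>= F] are fresh. *)
Definition num_form (N x : nat) : gform :=
  GAnd (comm_form (GVar x) (GVar N)) (comm_form (conj_term (S N) x) (GVar (S (S N)))).

(** The quantified variable ranges over the centralizer of [shift], that is over its integer powers,
    so all the conjugates [gen_at i] are reached. *)
Definition base_form (N w F : nat) : gform :=
  GNot (GEx F (GAnd (comm_form (GVar F) (GVar N))
                    (GNot (comm_form (GVar w) (conj_term (S N) F))))).

(** The variables [F], [S F], [S (S F)] stand for [v], [w], [u] of [mul_witness]; [3 + F] is left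
    for the bound variable of [base_form]. *)
Definition mul_form (N x y z F : nat) : gform :=
  GEx F (GEx (S F) (GEx (S (S F))
    (GAnd (GAnd (base_form N F (3 + F))
                (GAnd (base_form N (S F) (3 + F)) (base_form N (S (S F)) (3 + F))))
          (GAnd (GEq (GMul (conj_term F N) (GVar (S N))) (GMul (conj_term (S N) y) (GVar F)))
                (GAnd (GEq (GMul (conj_term (S F) x) (GVar (S N)))
                           (GMul (conj_term (S N) z) (GVar (S F))))
                      (GEq (GMul (conj_term (S (S F)) N) (GVar F))
                           (GMul (GVar (S F)) (GVar (S (S F)))))))))).

Lemma gmul_eq_iff f g f' g' : gmul f g = gmul f' g' <-> forall t, g (f t) = g' (f' t).
Proof.
  split; intros H.
  - intros t. exact (f_equal (fun h => h t) H).
  - extensionality t. apply H.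
Qed.

Lemma gsat_comm_form env x y :
  gsat G env (comm_form x y) <-> comm (geval env x) (geval env y).
Proof.
  simpl. rewrite gmul_eq_iff. split; intros H t; symmetry; apply H.
Qed.

Definition params (N : nat) (env : nat -> R -> R) : Prop :=
  env N = shift /\ env (S N) = gen /\ env (S (S N)) = low_bump.

Lemma geval_conj_term env w x i :
  env x = zpow shift i -> geval env (conj_term w x) = conj_shift i (env w).
Proof. intros H. simpl. now rewrite H, finv_zpow. Qed.

Lemma geval_conj_term_shift env w x : env x = shift -> geval env (conj_term w x) = conj_shift 1 (env w).
Proof. intros H. simpl. now rewrite H. Qed.

Lemma comm_zpow_shift i : comm (zpow shift i) shift.
Proof. apply comm_zpow; [easy|]. now intros t. Qed.

Lemma gsat_num_form N env x : params N env -> G (env x) ->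
  (gsat G env (num_form N x) <-> exists n : nat, env x = zpow shift (Z.of_nat n)).
Proof.
  intros (H1 & H2 & H3) Gx.
  change (gsat G env (num_form N x)) with
    (gsat G env (comm_form (GVar x) (GVar N)) /\
     gsat G env (comm_form (conj_term (S N) x) (GVar (S (S N))))).
  rewrite !gsat_comm_form. cbn [geval]. rewrite H1, H3. split.
  - intros [C C']. destruct (shift_centralizer _ Gx C) as [i Hi].
    rewrite (geval_conj_term _ _ _ i Hi), H2 in C'. apply gen_at_low in C'.
    exists (Z.to_nat i). now rewrite Z2Nat.id.
  - intros [n Hn]. rewrite (geval_conj_term _ _ _ _ Hn), H2, Hn.
    split; [apply comm_zpow_shift|]. apply gen_at_low. lia.
Qed.

Lemma gsat_base_form N env w F : params N env -> G (env w) -> (3 + N <= F)%nat -> w <> F ->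
  (gsat G env (base_form N w F) <-> in_base (env w)).
Proof.
  intros (H1 & H2 & H3) Gw HF Hw.
  assert (E : gsat G env (base_form N w F) <-> ~ exists g, G g /\
    comm g shift /\ ~ comm (env w) (geval (upd env F g) (conj_term (S N) F))).
  { apply not_iff_compat. split; intros (g & Gg & K); exists g; split; try easy.
    - change (gsat G (upd env F g) (comm_form (GVar F) (GVar N)) /\
              ~ gsat G (upd env F g) (comm_form (GVar w) (conj_term (S N) F))) in K.
      rewrite !gsat_comm_form in K. cbn [geval] in K.
      rewrite upd_same, !upd_other in K by lia. now rewrite H1 in K.
    - change (gsat G (upd env F g) (comm_form (GVar F) (GVar N)) /\
              ~ gsat G (upd env F g) (comm_form (GVar w) (conj_term (S N) F))).
      rewrite !gsat_comm_form. cbn [geval].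
      rewrite upd_same, !upd_other by lia. now rewrite H1. }
  rewrite E. clear E. split.
  - intros H. split; [easy|]. intros i. apply NNPP. intros C. apply H.
    exists (zpow shift i). split; [now apply G_zpow|]. split; [apply comm_zpow_shift|].
    rewrite (geval_conj_term _ _ _ i) by apply upd_same.
    rewrite upd_other, H2 by lia. exact C.
  - intros [_ C] (g & Gg & Cg & H). destruct (shift_centralizer g Gg Cg) as [i ->].
    apply H. rewrite (geval_conj_term _ _ _ i) by apply upd_same.
    rewrite upd_other, H2 by lia. apply C.
Qed.

Lemma gsat_mul_form N env x y z F (m n l : nat) :
  params N env -> (3 + N <= F)%nat -> (x < F)%nat -> (y < F)%nat -> (z < F)%nat ->
  env x = zpow shift (Z.of_nat m) -> env y = zpow shift (Z.of_nat n) -> env z = zpow shift (Z.of_nat l) ->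
  (gsat G env (mul_form N x y z F) <-> l = (m * n)%nat).
Proof.
  intros (H1 & H2 & H3) HF Hx Hy Hz Ex Ey Ez.
  assert (E : gsat G env (mul_form N x y z F) <-> exists v, G v /\ exists w, G w /\ exists u, G u /\
    ((in_base v /\ in_base w /\ in_base u) /\ mul_witness (Z.of_nat m) (Z.of_nat n) (Z.of_nat l) v w u)).
  { unfold mul_form.
    assert (Q : forall v w u, G v -> G w -> G u ->
      (gsat G (upd (upd (upd env F v) (S F) w) (S (S F)) u)
        (GAnd (GAnd (base_form N F (3 + F))
                (GAnd (base_form N (S F) (3 + F)) (base_form N (S (S F)) (3 + F))))
          (GAnd (GEq (GMul (conj_term F N) (GVar (S N))) (GMul (conj_term (S N) y) (GVar F)))
                (GAnd (GEq (GMul (conj_term (S F) x) (GVar (S N)))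
                           (GMul (conj_term (S N) z) (GVar (S F))))
                      (GEq (GMul (conj_term (S (S F)) N) (GVar F))
                           (GMul (GVar (S F)) (GVar (S (S F))))))))
       <-> ((in_base v /\ in_base w /\ in_base u) /\
            mul_witness (Z.of_nat m) (Z.of_nat n) (Z.of_nat l) v w u))).
    { intros v w u Gv Gw Gu.
      set (env' := upd (upd (upd env F v) (S F) w) (S (S F)) u).
      assert (V : env' F = v) by (unfold env'; now simpl_upd).
      assert (W : env' (S F) = w) by (unfold env'; now simpl_upd).
      assert (U : env' (S (S F)) = u) by (unfold env'; now simpl_upd).
      assert (O : forall j, (j < F)%nat -> env' j = env j) by (intros; unfold env'; now simpl_upd).
      assert (P : params N env') by (unfold params; rewrite !O by lia; auto).
      assert (B : forall j, (j < 3 + F)%nat -> G (env' j) ->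
        (gsat G env' (base_form N j (3 + F)) <-> in_base (env' j))).
      { intros j Hj Gj. apply gsat_base_form; try easy; lia. }
      cbn [gsat]. rewrite (B F), (B (S F)), (B (S (S F))), V, W, U by (rewrite ?V, ?W, ?U; lia || easy).
      apply and_iff_compat_l. unfold mul_witness. cbn [geval].
      rewrite !gmul_eq_iff.
      rewrite !(geval_conj_term_shift _ _ N) by (rewrite O by lia; easy).
      rewrite (geval_conj_term _ _ y (Z.of_nat n)) by (rewrite O by lia; easy).
      rewrite (geval_conj_term _ _ x (Z.of_nat m)) by (rewrite O by lia; easy).
      rewrite (geval_conj_term _ _ z (Z.of_nat l)) by (rewrite O by lia; easy).
      rewrite V, W, U, (O (S N)), H2 by lia. reflexivity. }
    split.
    - intros (v & Gv & w & Gw & u & Gu & K).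
      exists v. split; [easy|]. exists w. split; [easy|]. exists u. split; [easy|].
      now apply Q.
    - intros (v & Gv & w & Gw & u & Gu & K).
      exists v. split; [easy|]. exists w. split; [easy|]. exists u. split; [easy|].
      now apply Q. }
  rewrite E. split.
  - intros (v & _ & w & _ & u & _ & (Bv & Bw & Bu) & K). now apply (mul_sound m n l v w u).
  - intros ->. destruct (mul_complete m n) as (v & w & u & Bv & Bw & Bu & K).
    exists v. split; [apply Bv|]. exists w. split; [apply Bw|]. exists u. split; [apply Bu|]. easy.
Qed.

Definition represents (N : nat) (env : nat -> R -> R) (aenv : nat -> nat) : Prop :=
  forall v, (v < N)%nat -> env v = zpow shift (Z.of_nat (aenv v)).

Lemma params_upd N env v g : (v < N \/ 3 + N <= v)%nat -> params N env -> params N (upd env v g).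
Proof. intros Hv H. unfold params. now rewrite !upd_other by lia. Qed.

Lemma represents_upd N env aenv v g :
  (N <= v)%nat -> represents N env aenv -> represents N (upd env v g) aenv.
Proof. intros Hv H w Hw. rewrite upd_other by lia. now apply H. Qed.

(** Group terms cannot express products of numerals, so the graph of the term is defined instead:
    addition is multiplication of powers of [shift], multiplication is [mul_form]. The position [N]
    of the parameters stays free above a bound because a whole formula must use one common [N]. *)
Lemma term_graph (t : aterm) : exists N0, forall N, (N0 <= N)%nat ->
  forall F z, (3 + N <= F)%nat -> (z < F)%nat -> exists psi, forall env aenv,
    params N env -> represents N env aenv -> G (env z) ->
    (gsat G env psi <-> env z = zpow shift (Z.of_nat (aeval aenv t))).
Proof.
  (* Shared by both binary operations: the two fresh variables are forced to carry the values of the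
     subterms. *)
  assert (Two : forall (N F : nat) (s1 s2 : aterm) (psi_s psi_t : gform) (env : nat -> R -> R) aenv,
    (3 + N <= F)%nat -> params N env -> represents N env aenv ->
    (forall env aenv, params N env -> represents N env aenv -> G (env F) ->
       (gsat G env psi_s <-> env F = zpow shift (Z.of_nat (aeval aenv s1)))) ->
    (forall env aenv, params N env -> represents N env aenv -> G (env (S F)) ->
       (gsat G env psi_t <-> env (S F) = zpow shift (Z.of_nat (aeval aenv s2)))) ->
    forall phi, gsat G env (GEx F (GEx (S F) (GAnd (GAnd psi_s psi_t) phi))) <->
      gsat G (upd (upd env F (zpow shift (Z.of_nat (aeval aenv s1))))
                  (S F) (zpow shift (Z.of_nat (aeval aenv s2)))) phi).
  { intros N F s1 s2 psi_s psi_t env aenv HF Hp Hr' Hs Ht phi. cbn [gsat].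
    assert (Q : forall x y, G x -> G y ->
      (gsat G (upd (upd env F x) (S F) y) psi_s /\ gsat G (upd (upd env F x) (S F) y) psi_t) <->
      (x = zpow shift (Z.of_nat (aeval aenv s1)) /\ y = zpow shift (Z.of_nat (aeval aenv s2)))).
    { intros x y Gx Gy.
      assert (Hp' : params N (upd (upd env F x) (S F) y))
        by (apply params_upd; [lia|]; apply params_upd; [lia|easy]).
      assert (Hr'' : represents N (upd (upd env F x) (S F) y) aenv)
        by (apply represents_upd; [lia|]; apply represents_upd; [lia|easy]).
      rewrite (Hs _ aenv), (Ht _ aenv) by (easy || now simpl_upd). now simpl_upd. }
    split.
    - intros (x & Gx & y & Gy & K & K'). apply Q in K; try easy. destruct K as [-> ->]. exact K'.
    - intros K. exists (zpow shift (Z.of_nat (aeval aenv s1))). split; [now apply G_zpow|].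
      exists (zpow shift (Z.of_nat (aeval aenv s2))). split; [now apply G_zpow|].
      split; [apply Q; auto using G_zpow|easy]. }
  induction t as [v|s [Ns IHs] t [Nt IHt]|s [Ns IHs] t [Nt IHt]].
  - exists (S v). intros N HN F z HF Hz. exists (GEq (GVar z) (GVar v)).
    intros env aenv _ Hr' _. simpl. now rewrite (Hr' v) by lia.
  - exists (max Ns Nt). intros N HN F z HF Hz.
    destruct (IHs N ltac:(lia) (S (S F)) F ltac:(lia) ltac:(lia)) as [psi_s Hs].
    destruct (IHt N ltac:(lia) (S (S F)) (S F) ltac:(lia) ltac:(lia)) as [psi_t Ht].
    exists (GEx F (GEx (S F) (GAnd (GAnd psi_s psi_t) (GEq (GVar z) (GMul (GVar F) (GVar (S F))))))).
    intros env aenv Hp Hr' Gz. rewrite (Two N F s t psi_s psi_t env aenv) by easy.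
    cbn [gsat geval aeval]. simpl_upd.
    replace (gmul _ _) with (zpow shift (Z.of_nat (aeval aenv s + aeval aenv t))); [easy|].
    extensionality x. unfold gmul. rewrite <- zpow_add by easy. f_equal. lia.
  - exists (max Ns Nt). intros N HN F z HF Hz.
    destruct (IHs N ltac:(lia) (S (S F)) F ltac:(lia) ltac:(lia)) as [psi_s Hs].
    destruct (IHt N ltac:(lia) (S (S F)) (S F) ltac:(lia) ltac:(lia)) as [psi_t Ht].
    (* The guard [num_form] is needed since the meaning of [mul_form] is established only when [z]
       is a numeral. *)
    exists (GEx F (GEx (S F) (GAnd (GAnd psi_s psi_t)
              (GAnd (num_form N z) (mul_form N F (S F) z (S (S F))))))).
    intros env aenv Hp Hr' Gz. rewrite (Two N F s t psi_s psi_t env aenv) by easy.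
    set (env' := upd (upd env F _) (S F) _).
    assert (Hp' : params N env')
      by (apply params_upd; [lia|]; apply params_upd; [lia|easy]).
    assert (Ez : env' z = env z) by (unfold env'; now simpl_upd).
    assert (Em : forall l, env' z = zpow shift (Z.of_nat l) ->
      (gsat G env' (mul_form N F (S F) z (S (S F))) <-> l = (aeval aenv s * aeval aenv t)%nat)).
    { intros l El. apply gsat_mul_form; try lia; try easy; unfold env'; now simpl_upd. }
    change (gsat G env' (num_form N z) /\ gsat G env' (mul_form N F (S F) z (S (S F))) <->
      env z = zpow shift (Z.of_nat (aeval aenv s * aeval aenv t))).
    rewrite gsat_num_form by (easy || now rewrite Ez). rewrite <- Ez. split.
    + intros [[l El] K]. rewrite (Em l El) in K. now rewrite El, K.
    + intros K. split; [eexists; exact K|]. now rewrite (Em _ K).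
Qed.

(** An equation states that both terms have a common value, and quantifiers are relativized to
    numerals. Taking [N] above every variable of [chi], bound ones included, keeps the parameters
    from being overwritten. *)
Lemma form_translation (chi : aform) : exists N0, forall N, (N0 <= N)%nat ->
  exists psi, forall env aenv, params N env -> represents N env aenv ->
    (gsat G env psi <-> asat aenv chi).
Proof.
  induction chi as [s t|chi [N0 IH]|chi1 [N1 IH1] chi2 [N2 IH2]|v chi [N0 IH]].
  - destruct (term_graph s) as [Ns Hs]. destruct (term_graph t) as [Nt Ht].
    exists (max Ns Nt). intros N HN.
    destruct (Hs N ltac:(lia) (4 + N)%nat (3 + N)%nat ltac:(lia) ltac:(lia)) as [psi_s Ps].
    destruct (Ht N ltac:(lia) (4 + N)%nat (3 + N)%nat ltac:(lia) ltac:(lia)) as [psi_t Pt].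
    exists (GEx (3 + N) (GAnd psi_s psi_t)). intros env aenv Hp Hr'.
    assert (Q : forall g, G g -> (gsat G (upd env (3 + N) g) (GAnd psi_s psi_t) <->
      g = zpow shift (Z.of_nat (aeval aenv s)) /\ g = zpow shift (Z.of_nat (aeval aenv t)))).
    { intros g Gg.
      assert (Hp' : params N (upd env (3 + N) g)) by (apply params_upd; [lia|easy]).
      assert (Hr'' : represents N (upd env (3 + N) g) aenv) by (apply represents_upd; [lia|easy]).
      cbn [gsat]. rewrite (Ps _ aenv), (Pt _ aenv) by (easy || now rewrite upd_same).
      now rewrite upd_same. }
    split.
    + intros (g & Gg & K). apply Q in K; [|easy]. destruct K as [K1 K2].
      rewrite K1 in K2. apply zpow_shift_inj in K2. simpl. lia.
    + intros K. exists (zpow shift (Z.of_nat (aeval aenv s))). split; [now apply G_zpow|].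
      apply Q; [now apply G_zpow|]. simpl in K. now rewrite K.
  - exists N0. intros N HN. destruct (IH N HN) as [psi H]. exists (GNot psi).
    intros env aenv Hp Hr'. simpl. now rewrite (H env aenv).
  - exists (max N1 N2). intros N HN.
    destruct (IH1 N ltac:(lia)) as [psi1 H1]. destruct (IH2 N ltac:(lia)) as [psi2 H2].
    exists (GAnd psi1 psi2). intros env aenv Hp Hr'. simpl.
    now rewrite (H1 env aenv), (H2 env aenv).
  - exists (max N0 (S v)). intros N HN. destruct (IH N ltac:(lia)) as [psi H].
    exists (GEx v (GAnd (num_form N v) psi)). intros env aenv Hp Hr'.
    assert (Hp' : forall g, params N (upd env v g)) by (intros; apply params_upd; [lia|easy]).
    assert (Q : forall m, gsat G (upd env v (zpow shift (Z.of_nat m))) psi <-> asat (upd aenv v m) chi).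
    { intros m. apply H; [easy|]. intros w Hw. destruct (Nat.eq_dec w v) as [->|Hwv].
      - now rewrite !upd_same.
      - rewrite !upd_other by easy. now apply Hr'. }
    cbn [gsat asat]. split.
    + intros (g & Gg & K & K'). apply gsat_num_form in K; [|easy|now rewrite upd_same].
      rewrite upd_same in K. destruct K as [m ->]. exists m. now apply Q.
    + intros [m K]. exists (zpow shift (Z.of_nat m)). split; [now apply G_zpow|]. split; [|now apply Q].
      apply gsat_num_form; [easy|rewrite upd_same; now apply G_zpow|].
      exists m. apply upd_same.
Qed.

Fixpoint all_num_form (N j : nat) : gform :=
  match j with
  | O => GEq GOne GOne
  | S j' => GAnd (all_num_form N j') (num_form N j')
  end.

Lemma gsat_all_num_form N j env : params N env -> (forall v, (v < j)%nat -> G (env v)) ->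
  (gsat G env (all_num_form N j) <->
   forall v, (v < j)%nat -> exists n : nat, env v = zpow shift (Z.of_nat n)).
Proof.
  intros Hp. induction j as [|j IH]; intros Hj.
  - simpl. split; [lia|easy].
  - change (gsat G env (all_num_form N j) /\ gsat G env (num_form N j) <->
      forall v, (v < S j)%nat -> exists n : nat, env v = zpow shift (Z.of_nat n)).
    rewrite IH, gsat_num_form by auto. split.
    + intros [H H'] v Hv. destruct (Nat.eq_dec v j) as [->|]; [easy|]. apply H. lia.
    + intros H. split; auto.
Qed.

(** * The interpretation on nonnegative powers of [shift] *)

Definition is_num (ts : list (R -> R)) : Prop :=
  length ts = 1%nat /\ exists n : nat, nth 0 ts idf = zpow shift (Z.of_nat n).

Definition num_val (ts : list (R -> R)) : nat :=
  epsilon (inhabits 0%nat) (fun n => nth 0 ts idf = zpow shift (Z.of_nat n)).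

Lemma num_val_spec ts : is_num ts -> nth 0 ts idf = zpow shift (Z.of_nat (num_val ts)).
Proof. intros [_ H]. exact (epsilon_spec (inhabits 0%nat) _ H). Qed.

Lemma num_val_single n : num_val [zpow shift (Z.of_nat n)] = n.
Proof.
  assert (H : is_num [zpow shift (Z.of_nat n)]) by (split; [easy|now exists n]).
  apply num_val_spec in H. simpl in H. apply zpow_shift_inj in H. lia.
Qed.

Lemma tuple_env_lt tss rho v : (v < length tss)%nat ->
  tuple_env 1 tss rho v = nth 0 (nth v tss []) idf.
Proof.
  intros H. unfold tuple_env. rewrite Nat.mul_1_l, Nat.mod_1_r, Nat.div_1_r.
  now apply Nat.ltb_lt in H as ->.
Qed.

Lemma tuple_env_ge tss rho v : (length tss <= v)%nat -> tuple_env 1 tss rho v = rho v.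
Proof.
  intros H. unfold tuple_env. rewrite Nat.mul_1_l. now apply Nat.ltb_ge in H as ->.
Qed.

Lemma interprets : interprets_arith_with_params G.
Proof.
  exists 1%nat, is_num, num_val. split; [|split].
  - intros ts H. split; [apply H|]. destruct H as [H [n Hn]].
    destruct ts as [|x [|y ts]]; try easy. simpl in Hn. subst x.
    constructor; [now apply G_zpow|constructor].
  - intros m. exists [zpow shift (Z.of_nat m)]. split; [|apply num_val_single].
    split; [easy|now exists m].
  - intros j X [chi Hchi]. destruct (form_translation chi) as [N0 HN0].
    set (N := max N0 j). destruct (HN0 N ltac:(lia)) as [psi Hpsi].
    exists (GAnd (all_num_form N j) psi).
    (* [chi] may mention variables from [j] up to [N]. They receive the identity, which is the
       numeral [0] and matches the default value [0] of [aenv] below. *)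
    exists (fun v => if Nat.eqb v N then shift else if Nat.eqb v (S N) then gen
                     else if Nat.eqb v (S (S N)) then low_bump else idf).
    set (rho := fun v : nat => _). split.
    { intros v. unfold rho. destruct (Nat.eqb v N); [exact Gsh|].
      destruct (Nat.eqb v (S N)); [exact Ggen|].
      destruct (Nat.eqb v (S (S N))); [exact Glow|exact G_idf]. }
    intros tss Hlen HF. set (env := tuple_env 1 tss rho).
    assert (Elt : forall v, (v < j)%nat -> env v = nth 0 (nth v tss []) idf)
      by (intros; apply tuple_env_lt; lia).
    assert (Ege : forall v, (j <= v)%nat -> env v = rho v)
      by (intros; apply tuple_env_ge; lia).
    assert (Hp : params N env).
    { unfold params. rewrite !Ege by lia. unfold rho.
      rewrite !Nat.eqb_refl, !(proj2 (Nat.eqb_neq _ _)) by lia. easy. }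
    assert (Hts : forall v, (v < j)%nat -> length (nth v tss []) = 1%nat /\ Forall G (nth v tss [])).
    { intros v Hv. rewrite Forall_forall in HF. apply HF, nth_In. lia. }
    assert (HGe : forall v, (v < j)%nat -> G (env v)).
    { intros v Hv. rewrite Elt by easy. destruct (Hts v Hv) as [L FG].
      rewrite Forall_forall in FG. apply FG, nth_In. lia. }
    assert (HD : Forall is_num tss <-> gsat G env (all_num_form N j)).
    { rewrite gsat_all_num_form by easy. rewrite Forall_forall. split.
      - intros H v Hv. rewrite Elt by easy. apply H, nth_In. lia.
      - intros H ts Hin. apply (In_nth _ _ []) in Hin. destruct Hin as (v & Hv & <-).
        split; [apply Hts; lia|]. rewrite <- Elt by lia. apply H. lia. }
    change (gsat G env (GAnd (all_num_form N j) psi)) with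
      (gsat G env (all_num_form N j) /\ gsat G env psi).
    rewrite <- HD.
    enough (E : Forall is_num tss -> (X (map num_val tss) <-> gsat G env psi)) by tauto.
    intros HDt.
    set (aenv := fun v => if Nat.ltb v j then num_val (nth v tss []) else 0%nat).
    assert (Hrep : represents N env aenv).
    { intros v Hv. unfold aenv. destruct (Nat.ltb_spec v j) as [L|L].
      - rewrite Elt by easy. apply num_val_spec. rewrite Forall_forall in HDt.
        apply HDt, nth_In. lia.
      - rewrite Ege by easy. unfold rho.
        destruct (Nat.eqb_spec v N) as [->|]; [|destruct (Nat.eqb_spec v (S N)) as [->|];
          [|destruct (Nat.eqb_spec v (S (S N))) as [->|]]]; reflexivity || lia. }
    rewrite (Hpsi env aenv Hp Hrep), <- Hchi.
    replace (map aenv (seq 0 j)) with (map num_val tss); [easy|].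
    apply (nth_ext _ _ (num_val []) (aenv 0%nat)).
    { now rewrite !length_map, length_seq. }
    intros v Hv. rewrite length_map in Hv. rewrite !map_nth, seq_nth by lia.
    unfold aenv. simpl. now destruct (Nat.ltb_spec v j); [|lia].
Qed.

End Group.

(** A slope other than [1], or its inverse, is less than [1], and its powers tend to [0]. *)
Lemma exists_small_slope r Lam A : admissible r Lam A -> (exists l, Lam l /\ l <> 1) ->
  exists k, Lam k /\ 0 < k <= 1 / 4.
Proof.
  intros (_ & HLp & HL1 & HLm & HLi & _) (l & Hl & Hl1).
  assert (E : exists x, Lam x /\ 0 < x < 1).
  { pose proof (HLp l Hl). destruct (Rtotal_order l 1) as [L|[L|L]]; [now exists l|easy|].
    exists (/ l). split; [auto|]. split; [now apply Rinv_0_lt_compat|].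
    rewrite <- Rinv_1. apply Rinv_lt_contravar; lra. }
  destruct E as (x & Hx & Hx1).
  destruct (pow_lt_1_zero x) with (y := 1 / 4) as [n Hn];
    [rewrite Rabs_pos_eq; lra|lra|].
  exists (x ^ n). assert (0 < x ^ n) by (apply pow_lt; lra). split.
  - clear Hn H. induction n as [|n IH]; simpl; auto.
  - specialize (Hn n ltac:(lia)). apply Rabs_def2 in Hn. lra.
Qed.

Theorem theoremA (r : R) (Lam A : R -> Prop) (G : (R -> R) -> Prop) :
  admissible r Lam A ->
  (exists l, Lam l /\ l <> 1) ->
  subgroupV r G ->
  (forall f, (G f /\ Fel r posR allR f) <-> Fel r Lam A f) ->
  interprets_arith_with_params G.
Proof.
  intros Hadm Hl HG HF.
  destruct (exists_small_slope r Lam A Hadm Hl) as (k & HLk & Hk).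
  pose proof Hadm as (Hr & _ & _ & _ & _ & A0 & HAadd & _ & Ar & HAmul).
  assert (GF : forall f, Fel r Lam A f -> G f) by (intros f Hf; now apply HF).
  pose proof (pivot_order r k Hr Hk) as Ho.
  (* The ends of the bumps are [pivot = k^2 r + k^3 r] and its image [k r + k^2 r], both in [A] by
     stability under [k]. *)
  assert (Ap : A (pivot r k)).
  { unfold pivot, brk1. replace (0 + (r - 0) * (k ^ 2 + k ^ 3)) with (k * (k * r) + k * (k * (k * r)))
      by ring. auto. }
  assert (Aq : A (shift r k (pivot r k))).
  { unfold shift. pose proof (brk_order k 0 r Hk Hr) as Hb. fold (pivot r k) in *.
    rewrite bump_piece1 by (unfold pivot in *; lra).
    replace (0 + (pivot r k - 0) / k) with (k * r + k * (k * r))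
      by (unfold pivot, brk1; field; lra). auto. }
  apply (interprets r k G Hr Hk HG); apply GF; apply bump_Fel; try easy; lra.
Qed.
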